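(* Let $d=2$. The functions $\Phi_{i,j}$ ($i=1,\dots,N_T$, $j=1,2$), $\Upsilon_i$ ($i=1,\dots,N_E$) and $\Lambda_i$ ($i=1,\dots,N_V$) form a basis of the discretely divergence-free space $$D_h=\{\mathbf{v}\in V_h^0:\ b(\mathbf{v},q)=0\ \ \forall q\in W_h\},$$ i.e. $$D_h=\mathrm{span}\{\Phi_{i,j},\ i=1,\dots,N_T,\ j=1,2;\ \Upsilon_i,\ i=1,\dots,N_E;\ \Lambda_i,\ i=1,\dots,N_V\}.$$
   Context: Let $\Omega\subset\mathbb{R}^2$ be a domain and $\mathcal{T}_h=\{T_1,\dots,T_{N_T}\}$ a shape-regular triangulation of $\Omega$ with set of edges $\mathcal{E}_h$, set of interior edges $\mathcal{E}_h^0=\mathcal{E}_h\setminus\partial\Omega=\{e_1,\dots,e_{N_E}\}$ and set of interior vertices $\mathcal{V}_h=\{P_1,\dots,P_{N_V}\}$. Thus $N_T$, $N_E$, $N_V$ are the numbers of triangles, interior edges and interior vertices. $P_0$ denotes constant functions, $|e|$ is the length of an edge $e$, $(\cdot,\cdot)_T$ and $\langle\cdot,\cdot\rangle_{\partial T}$ are the $L^2(T)$ and $L^2(\partial T)$ inner products, $\mathbf{n}$ is the unit outward normal on $\partial T$, and $L_0^2(\Omega)$ is the space of $L^2(\Omega)$ functions with mean value zero. Weak functions: $\mathbf{v}=\{\mathbf{v}_0,\mathbf{v}_b\}$ consists of an interior part $\mathbf{v}_0$, defined on the interior of each $T$, and a boundary part $\mathbf{v}_b$, defined on the edges. The two parts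 are independent, and $\mathbf{v}_b$ has a single value on each edge. Set $$V_h=\{\mathbf{v}=\{\mathbf{v}_0,\mathbf{v}_b\}:\ \mathbf{v}_0|_T\in[P_0(T)]^2\ \forall T\in\mathcal{T}_h,\ \mathbf{v}_b|_e\in[P_0(e)]^2\ \forall e\in\mathcal{E}_h\},$$ $$V_h^0=\{\mathbf{v}\in V_h:\ \mathbf{v}_b=0\text{ on }\partial\Omega\},\qquad W_h=\{q\in L_0^2(\Omega):\ q|_T\in P_0(T)\ \forall T\in\mathcal{T}_h\}.$$ For $\mathbf{v}\in V_h$ the weak divergence $\nabla_w\cdot\mathbf{v}|_T\in P_0(T)$ is the unique constant with $(\nabla_w\cdot\mathbf{v},q)_T=-(\mathbf{v}_0,\nabla q)_T+\langle\mathbf{v}_b,q\mathbf{n}\rangle_{\partial T}$ for all $q\in P_0(T)$, and $b(\mathbf{v},q)=\sum_{T\in\mathcal{T}_h}(\nabla_w\cdot\mathbf{v},q)_T$. Piecewise constant basis functions: let $\phi_i$ be the scalar weak function equal to $1$ on the interior of $T_i$ and $0$ elsewhere (on all other triangle interiors and on all edges), and $\psi_i$ the scalar weak function equal to $1$ on the interior edge $e_i$ and $0$ elsewhere (on all triangle interiors and all other edges). Put $$\Phi_{i,1}=\begin{pmatrix}\phi_i\\0\end{pmatrix},\quad \Phi_{i,2}=\begin{pmatrix}0\\\phi_i\end{pmatrix}\ (i=1,\dots,N_T),\qquad \Psi_{i,1}=\begin{pmatrix}\psi_i\\0\end{pmatrix},\quad \Psi_{i,2}=\begin{pmatrix}0\\\psi_i\end{pmatrix}\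 (i=1,\dots,N_E).$$ Tangential functions: for each interior edge $e_i$ with unit tangential vector $\mathbf{t}_{e_i}$, $\Upsilon_i=C_1\Psi_{i,1}+C_2\Psi_{i,2}$ with constants $C_1,C_2$ chosen so that $\Upsilon_i|_{e_i}=\mathbf{t}_{e_i}$ (so $\Upsilon_i$ is nonzero only on $e_i$). Vertex functions: for an interior vertex $P_i\in\mathcal{V}_h$, let $e_{j}$, $j=1,\dots,r$ (local numbering), be the interior edges having $P_i$ as an endpoint, where $r$ is the number of triangles having $P_i$ as a vertex, and let $\mathbf{n}_{e_j}$ be the unit normal to $e_j$ oriented so that $\mathbf{n}_{e_1},\dots,\mathbf{n}_{e_r}$ all point counterclockwise around $P_i$. Let $\Theta_j=C_1\Psi_{j,1}+C_2\Psi_{j,2}$ with constants $C_1,C_2$ such that $\Theta_j|_{e_j}=\mathbf{n}_{e_j}$, and define $\Lambda_i=\sum_{j=1}^r\frac{1}{|e_j|}\Theta_j$.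
   Formalization: The domain Ω is additionally assumed simply connected; for a domain with holes (e.g. a square annulus with 8 triangles, 8 interior edges and no interior vertex, dim D_h = 25 against 24 functions) the family does not span D_h. *)

(* Defs.v *)
From HB Require Import structures.
From mathcomp Require Import all_boot all_order all_algebra.
From mathcomp Require Import all_classical all_reals all_analysis.

Set Implicit Arguments.
Unset Strict Implicit.
Unset Printing Implicit Defensive.

Import Order.TTheory GRing.Theory Num.Theory.
Import numFieldNormedType.Exports.

Local Open Scope classical_set_scope.
Local Open Scope ring_scope.

(* The library norm on [R * R] is the sup norm: it is used only through the
   topology it induces.  Euclidean lengths are written with [enorm]. *)
Notation plane R := (R * R)%type.

Section Plane.
Context {R : realType}.
Implicit Types (a b p : plane R) (A : set (plane R)).

Definition dot a b : R := a.1 * b.1 + a.2 * b.2.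

(* [cross a b > 0] iff [b] points to the left of [a]. *)
Definition cross a b : R := a.1 * b.2 - a.2 * b.1.

Definition enorm a : R := Num.sqrt (dot a a).

Definition boundary A : set (plane R) := closure A `\` interior A.

Definition domain A : Prop := [/\ open A, connected A & A !=set0].

(* Every loop in [A] contracts to its base point inside [A]. Path-connectedness,
   automatic for a domain, is not repeated here. *)
Definition simply_connected A : Prop :=
  forall g : R -> plane R,
    {within `[0, 1], continuous g} -> g @` `[0, 1] `<=` A -> g 0 = g 1 ->
  exists H : plane R -> plane R,
    [/\ {within `[0, 1] `*` `[0, 1], continuous H},
        H @` (`[0, 1] `*` `[0, 1]) `<=` A,
        forall t, t \in `[0, 1] -> H (0, t) = g t /\ H (1, t) = g 0
      & forall s, s \in `[0, 1] -> H (s, 0) = g 0 /\ H (s, 1) = g 0].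

Definition lebesgue2 := (@lebesgue_measure R \x @lebesgue_measure R)%E.

End Plane.

Section Simplices.
Context {R : realType} {P : finType}.
Implicit Types (pt : P -> plane R) (S : {set P}).

(* Barycentric coordinates supported on [S]; the hull of [set0] is empty. *)
Definition hull pt S : set (plane R) :=
  [set x | exists w : P -> R,
    [/\ forall i, 0 <= w i, forall i, i \notin S -> w i = 0,
        \sum_i w i = 1 & x = \sum_i w i *: pt i]].

(* Relative interior of the simplex (for a triangle, its interior). *)
Definition ohull pt S : set (plane R) :=
  [set x | exists w : P -> R,
    [/\ forall i, i \in S -> 0 < w i, forall i, i \notin S -> w i = 0,
        \sum_i w i = 1 & x = \sum_i w i *: pt i]].

End Simplices.

(* Triangles are sets of three vertices, edges are two-element subsets of
   triangles; [pt] gives the position of the vertices. *)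
Record triangulation (R : realType) (Om : set (plane R)) := Triangulation {
  vert : finType;
  pt : vert -> plane R;
  tris : {set {set vert}};
  pt_inj : injective pt;
  tris_card : forall T, T \in tris -> #|T| = 3%N;
  tris_nondegenerate : forall T a b c, T \in tris ->
    a \in T -> b \in T -> c \in T -> uniq [:: a; b; c] ->
    cross (pt b - pt a) (pt c - pt a) != 0;
  tris_conforming : forall T T', T \in tris -> T' \in tris ->
    hull pt T `&` hull pt T' = hull pt (T :&: T')%SET;
  tris_cover : \bigcup_(T in [set T | T \in tris]) hull pt T = closure Om;
  (* The next two clauses follow from the previous ones when [Om] is the interior
     of its closure. In general they say that the mesh resolves the boundary
     of [Om], so that each edge is either interior or part of it. *)
  tris_inside : forall T, T \in tris -> ohull pt T `<=` Om;
  edges_resolved : forall (T e : {set vert}), T \in tris -> e \subset T -> #|e| = 2%N ->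
    ohull pt e `<=` Om \/ hull pt e `<=` boundary Om
}.

Section Mesh.
Context {R : realType} {Om : set (plane R)} (M : triangulation Om).

Local Notation pt := (@pt R Om M).
Local Notation tris := (@tris R Om M).

(* For every triangle, diameter <= sigma * (diameter of an inscribed disc). *)
Definition shape_regular (sigma : R) : Prop :=
  forall T, T \in tris -> exists c : plane R, exists r : R,
    [/\ 0 < r, [set x | enorm (x - c) <= r] `<=` hull pt T
      & forall x y, hull pt T x -> hull pt T y ->
          enorm (x - y) <= sigma * (r *+ 2)].

Definition triangle : Type := {T : {set vert M} | T \in tris}.
HB.instance Definition _ := SubFinite.on triangle.

Definition is_edge (e : {set vert M}) : bool :=
  (#|e| == 2%N) && [exists T in tris, e \subset T].

Definition edge : Type := {e : {set vert M} | is_edge e}.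
HB.instance Definition _ := SubFinite.on edge.

Definition interior_edge (e : edge) : bool :=
  ~~ `[< hull pt (val e) `<=` boundary Om >].

Definition interior_vertex (p : vert M) : bool :=
  [exists T in tris, p \in T] && ~~ `[< boundary Om (pt p) >].

Definition edge_length (e : edge) : R :=
  if enum (val e) is [:: a; b] then enorm (pt b - pt a) else 0.

(* Integral over an edge with respect to arc length. *)
Definition edge_integral (e : edge) (f : plane R -> R) : R :=
  if enum (val e) is [:: a; b] then
    \int[lebesgue_measure]_(t in `[0, 1])
      (f (pt a + t *: (pt b - pt a)) * enorm (pt b - pt a))
  else 0.

Definition unit_tangent (e : edge) (t : plane R) : Prop :=
  enorm t = 1 /\
  forall a b, a \in val e -> b \in val e -> cross (pt b - pt a) t = 0.

Definition unit_normal (e : edge) (n : plane R) : Prop :=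
  enorm n = 1 /\
  forall a b, a \in val e -> b \in val e -> dot (pt b - pt a) n = 0.

(* The unit normal to [e] pointing out of [T]; meaningful for [e] an edge of [T]. *)
Definition outward_normal (T : triangle) (e : edge) : plane R :=
  get [set n | unit_normal e n /\
    forall a c, a \in val e -> c \in val T -> c \notin val e ->
      dot (pt c - pt a) n < 0].

(* The unit normal to [e] pointing counterclockwise around its endpoint [p]. *)
Definition ccw_normal (p : vert M) (e : edge) : plane R :=
  get [set n | unit_normal e n /\
    forall q, q \in val e -> q != p -> 0 < cross (pt q - pt p) n].

(* A piecewise constant scalar weak function is represented by its values on
   the triangle interiors and on the edges. *)
Definition Sh : Type := ({ffun triangle -> R^o} * {ffun edge -> R^o})%type.
HB.instance Definition _ := Vector.on Sh.

(* The two Cartesian components of a vector-valued weak function. *)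
Definition Vh : Type := (Sh * Sh)%type.
HB.instance Definition _ := Vector.on Vh.

Definition interior_part (v : Vh) (T : triangle) : plane R :=
  (v.1.1 T, v.2.1 T).

Definition boundary_part (v : Vh) (e : edge) : plane R :=
  (v.1.2 e, v.2.2 e).

Definition Vh0 : set Vh :=
  [set v | forall e, ~~ interior_edge e -> boundary_part v e = 0].

Definition inner_tri (T : triangle) (f g : plane R -> R) : R :=
  \int[lebesgue2]_(x in ohull pt (val T)) (f x * g x).

(* Inner product in [L^2(T)^2] of [u] and the gradient of [q]. *)
Definition inner_tri_grad (T : triangle) (u : plane R -> plane R)
    (q : plane R -> R) : R :=
  \int[lebesgue2]_(x in ohull pt (val T))
    dot (u x) ('D_((1, 0) : plane R) q x, 'D_((0, 1) : plane R) q x).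

(* [<vb, q n>] on the boundary of [T]. *)
Definition flux (v : Vh) (T : triangle) (q : plane R -> R) : R :=
  \sum_(e : edge | val e \subset val T)
    edge_integral e
      (fun x => dot (boundary_part v e) (q x *: outward_normal T e)).

Definition weak_div (v : Vh) (T : triangle) : R :=
  get [set d | forall c : R,
    inner_tri T (cst d) (cst c) =
    - inner_tri_grad T (cst (interior_part v T)) (cst c) + flux v T (cst c)].

(* The piecewise constant function with value [q T] inside [T]. *)
Definition pw_const (q : triangle -> R) (x : plane R) : R :=
  \sum_(T : triangle) q T * \1_(ohull pt (val T)) x.

Definition Wh : set (triangle -> R) :=
  [set q | \int[lebesgue2]_(x in Om) pw_const q x = 0].

Definition bform (v : Vh) (q : triangle -> R) : R :=
  \sum_(T : triangle) inner_tri T (cst (weak_div v T)) (cst (q T)).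

Definition Dh : set Vh := [set v | Vh0 v /\ forall q, Wh q -> bform v q = 0].

Definition phi (T : triangle) : Sh := ([ffun T' => (T' == T)%:R], 0).
Definition psi (e : edge) : Sh := (0, [ffun e' => (e' == e)%:R]).

Definition Phi1 (T : triangle) : Vh := (phi T, 0).
Definition Phi2 (T : triangle) : Vh := (0, phi T).
Definition Psi1 (e : edge) : Vh := (psi e, 0).
Definition Psi2 (e : edge) : Vh := (0, psi e).

Definition Upsilon (tau : edge -> plane R) (e : edge) : Vh :=
  (tau e).1 *: Psi1 e + (tau e).2 *: Psi2 e.

Definition Theta (p : vert M) (e : edge) : Vh :=
  (ccw_normal p e).1 *: Psi1 e + (ccw_normal p e).2 *: Psi2 e.

Definition Lambda (p : vert M) : Vh :=
  \sum_(e : edge | interior_edge e && (p \in val e))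
    (edge_length e)^-1 *: Theta p e.

Definition div_free_basis (tau : edge -> plane R) : seq Vh :=
  [seq Phi1 T | T <- enum {: triangle}] ++ [seq Phi2 T | T <- enum {: triangle}] ++
  [seq Upsilon tau e | e <- enum interior_edge] ++
  [seq Lambda p | p <- enum interior_vertex].

End Mesh.

Arguments Vh0 {R Om} M.
Arguments Wh {R Om} M.
Arguments Dh {R Om} M.

(* Main.v *)
Require Import Defs.
From HB Require Import structures.
From mathcomp Require Import all_boot all_order all_algebra fingraph.
From mathcomp Require Import all_classical all_reals all_analysis measurable_realfun.
From mathcomp Require Import ring lra.

Set Implicit Arguments.
Unset Strict Implicit.
Unset Printing Implicit Defensive.

Import Order.TTheory GRing.Theory Num.Theory.
Import numFieldNormedType.Exports.

Local Open Scope classical_set_scope.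
Local Open Scope ring_scope.

(** Only net flows through edges matter for the constraint: on constants the weak
    divergence of [v] on a triangle is the net flow out of the triangle divided
    by its area ([weak_divE]), and orthogonality to functions of mean zero forces
    all net flows to vanish, because the total flow is zero ([DhP]). Interior
    values and tangential components are thus free, which accounts for the
    functions Phi and Upsilon. What remains is to describe the normal
    components: a combination of the functions Lambda with coefficients [c] has
    flow [c a - c b] through the edge from [a] to [b], with [c] extended by zero
    to boundary vertices. So the task is to find, for a divergence-free flow, a
    stream function on the vertices that vanishes on the boundary, and to show
    that it is unique.

    Uniqueness is a maximum principle. A function whose differences along interior
    edges vanish, and which is nonzero somewhere, is considered at the rightmost
    vertex where it is nonzero; that vertex is interior, its neighbours carry the
    same value, and one of them is further to the right
    ([interior_value_constant_eq0]).

    For existence, view the flow as a weighted family of segments which join the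
    centroid of each triangle to the midpoints of its edges, and let [stream v p] be
    its winding number around [p]. Winding numbers are computed by counting signed
    crossings with a horizontal half-line starting at [p], and additivity on
    triangles that avoid [p] is plain algebra ([crossing_triangle]).
    - If [p] moves from one end of an edge to the other, the winding number changes
      by the flow through that edge ([stream_edge]).
    - If [p] is not in the domain, the winding number is zero ([stream_boundary]):
      a closed polygon in a simply connected set does not wind around a point of
      the complement ([closed_polyline_crossing]), so crossings derive from a
      potential on the graph of triangles and edges ([closed_walk_potential]),
      and a divergence-free flow is orthogonal to potential differences.

    The geometric input is that an interior edge has exactly one triangle on each
    side ([interior_edge_sides]), which follows from the openness of the domain and
    the conformity of the triangulation. *)

(** * Signed crossings of a half-line *)

Section PlaneAlgebra.
Context {R : realType}.
Implicit Types (a b c p q u w x y : plane R).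

Let fstZ (k : R) a : (k *: a).1 = k * a.1. Proof. by []. Qed.
Let sndZ (k : R) a : (k *: a).2 = k * a.2. Proof. by []. Qed.
Let fstD a b : (a + b).1 = a.1 + b.1. Proof. by []. Qed.
Let sndD a b : (a + b).2 = a.2 + b.2. Proof. by []. Qed.
Let fstN a : (- a).1 = - a.1. Proof. by []. Qed.
Let sndN a : (- a).2 = - a.2. Proof. by []. Qed.
Let fst0 : (0 : plane R).1 = 0. Proof. by []. Qed.
Let snd0 : (0 : plane R).2 = 0. Proof. by []. Qed.
Definition planeE := (fstZ, sndZ, fstD, sndD, fstN, sndN, fst0, snd0).

Lemma plane_eq a b : a.1 = b.1 -> a.2 = b.2 -> a = b.
Proof. by case: a b => [? ?] [? ?] /= -> ->. Qed.

(** The closed upper half-plane, with the axis counted on one side only, so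
    that a polygon may pass through vertices on the axis without a case apart. *)
Definition upper a : R := ((0 <= a.2)%R)%:R.

(** The contribution of the segment from [a] to [b] to the winding number of a
    polygon around the origin: [1] if it crosses the positive first axis
    upwards, [-1] if downwards, [0] otherwise. When the two ends lie on different sides
    of the axis, the sign of [cross a b] tells which half of the axis is met. *)
Definition crossing a b : R :=
  if 0 < cross a b * (upper b - upper a) then upper b - upper a else 0.

Lemma crossC a b : cross a b = - cross b a.
Proof. by rewrite /cross; ring. Qed.

Lemma crossing_anti a b : crossing b a = - crossing a b.
Proof.
rewrite /crossing crossC -opprB mulrNN.
by case: ifP; rewrite ?oppr0.
Qed.

Lemma crossing_diag a : crossing a a = 0.
Proof. by rewrite /crossing subrr mulr0 ltxx. Qed.

(** The origin is not in the (possibly degenerate) triangle [a b c]; weights are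
    not normalised, which spares divisions. *)
Definition origin_off a b c : Prop := forall al be ga : R,
  0 <= al -> 0 <= be -> 0 <= ga -> 0 < al + be + ga ->
  al *: a + be *: b + ga *: c = 0 -> False.

Lemma origin_off_rot a b c : origin_off a b c -> origin_off b c a.
Proof.
move=> h al be ga al0 be0 ga0 pos E.
apply: (h ga al be) => //; first lra.
by rewrite -E [RHS]addrC addrA.
Qed.

(** A triangle inside an open half-plane whose edge passes through the origin
    avoids the origin. *)
Lemma origin_off_dot w a b c :
  0 < dot a w -> 0 < dot b w -> 0 < dot c w -> origin_off a b c.
Proof.
move=> aw bw cw al be ga al0 be0 ga0 pos E.
have : al * dot a w + be * dot b w + ga * dot c w = 0.
  move: (congr1 (fun v => dot v w) E); rewrite /dot !planeE !mul0r addr0 => <-.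
  by ring.
have h1 : 0 <= al * dot a w by rewrite mulr_ge0 // ltW.
have h2 : 0 <= be * dot b w by rewrite mulr_ge0 // ltW.
have h3 : 0 <= ga * dot c w by rewrite mulr_ge0 // ltW.
move=> S.
have /eqP: al * dot a w = 0 by lra.
have /eqP: be * dot b w = 0 by lra.
have /eqP: ga * dot c w = 0 by lra.
rewrite !mulf_eq0 !(gt_eqF aw, gt_eqF bw, gt_eqF cw) !orbF.
by move=> /eqP ? /eqP ? /eqP ?; lra.
Qed.

Lemma origin_off_collinear a b (s : R) : 0 <= s <= 1 ->
  (forall t : R, 0 <= t <= 1 -> a + t *: (b - a) != 0) ->
  origin_off a (a + s *: (b - a)) b.
Proof.
move=> /andP[s0 s1] h al be ga al0 be0 ga0 pos E.
have S0 : al + be + ga != 0 by rewrite gt_eqF.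
set t := (be * s + ga) / (al + be + ga).
have t01 : 0 <= t <= 1.
  rewrite /t ler_pdivrMr // ler_pdivlMr // mul0r mul1r.
  by apply/andP; split; nra.
move: (h t t01) => /negP; apply; apply/eqP.
have -> : a + t *: (b - a) = (al + be + ga)^-1 *:
    (al *: a + be *: (a + s *: (b - a)) + ga *: b).
  by rewrite /t; apply: plane_eq; rewrite !planeE; field.
by rewrite E scaler0.
Qed.

(** The relation that puts the origin in the triangle [a b c] if the three
    coefficients have the same sign and do not all vanish. *)
Lemma origin_cross_combination a b c :
  cross b c *: a + cross c a *: b + cross a b *: c = 0.
Proof.
by rewrite /cross; apply: plane_eq; rewrite !planeE; ring.
Qed.

(** Otherwise all coefficients of [origin_cross_combination] would be
    nonnegative: the third sign follows by looking at second coordinates. *)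
Let cross_pos a b c : origin_off a b c -> a.2 < 0 -> 0 <= b.2 -> 0 <= c.2 ->
  0 < cross a b -> 0 < cross a c.
Proof.
move=> h a2 b2 c2 ab; rewrite ltNge; apply/negP => ac.
have ca : 0 <= cross c a by rewrite crossC; lra.
have := congr1 snd (origin_cross_combination a b c).
rewrite !planeE => E.
have bc : 0 <= cross b c by case: (leP 0 (cross b c)) => // bc; nra.
apply: (h _ _ _ bc ca (ltW ab)); first lra.
exact: origin_cross_combination.
Qed.

Let cross_neg a b c : origin_off a b c -> 0 <= a.2 -> b.2 < 0 -> c.2 < 0 ->
  cross a b < 0 -> cross a c < 0.
Proof.
move=> h a2 b2 c2 ab; rewrite ltNge; apply/negP => ac.
have := origin_cross_combination a c b; rewrite addrAC (crossC b a) => E0.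
have := congr1 snd E0; rewrite !planeE => E.
have cb : 0 <= cross c b by case: (leP 0 (cross c b)) => // cb; nra.
by apply: (h _ _ _ cb ac _ _ E0); lra.
Qed.

Let origin_off_swap a b c : origin_off a b c -> origin_off a c b.
Proof.
move=> h al be ga al0 be0 ga0 pos E.
apply: (h al ga be) => //; first lra.
by rewrite addrAC.
Qed.

(** Of the three sides, only the two at [a] change half-plane, and they meet the
    same half of the axis because the triangle avoids the origin. *)
Let crossing_mixed a b c : origin_off a b c ->
  upper b = upper c -> upper a != upper b ->
  crossing a b + crossing b c + crossing c a = 0.
Proof.
move=> h bc ab; rewrite (crossing_anti a c) /crossing bc subrr mulr0 ltxx addr0.
suff -> : (0 < cross a b * (upper c - upper a)) = (0 < cross a c * (upper c - upper a)).
  by rewrite subrr.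
have h' := origin_off_swap h.
move: ab bc; rewrite /upper.
case: (leP 0 a.2) => a2; case: (leP 0 b.2) => b2; case: (leP 0 c.2) => c2 //=;
  rewrite ?eqxx // => _ E; try (by move: E; lra).
- rewrite sub0r !mulrN1 !oppr_gt0.
  by apply/idP/idP; apply: cross_neg.
- rewrite subr0 !mulr1.
  by apply/idP/idP; apply: cross_pos.
Qed.

(** The local form of homotopy invariance: the boundary of a triangle that
    avoids the origin does not wind around it. *)
Lemma crossing_triangle a b c : origin_off a b c ->
  crossing a b + crossing b c + crossing c a = 0.
Proof.
move=> h.
have [bc|bc] := eqVneq (upper b) (upper c).
  have [ab|ab] := eqVneq (upper a) (upper b); last exact: crossing_mixed.
  by rewrite /crossing -bc ab subrr !mulr0 ltxx !addr0.
have [ca|ca] := eqVneq (upper c) (upper a).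
  rewrite -addrA addrC; apply: crossing_mixed => //; exact: origin_off_rot.
have [ab|ab] := eqVneq (upper a) (upper b).
  rewrite addrC addrA; apply: crossing_mixed => //.
  exact/origin_off_rot/origin_off_rot.
exfalso; move: bc ca ab; rewrite /upper.
by do 3 case: (0 <= _); rewrite ?eqxx.
Qed.

End PlaneAlgebra.

(** * Closed polygons in a simply connected set *)

Section Winding.
Context {R : realType}.
Implicit Types (p w x : plane R) (K : set (plane R)).

Lemma dot_continuous p w : continuous (fun x : plane R => dot (x - p) w).
Proof.
move=> x; rewrite /dot; apply: cvgD; (apply: cvgMl => /=; apply: cvgB; last exact: cvg_cst).
- exact: cvg_fst.
- exact: cvg_snd.
Qed.

(** A Lebesgue number for the cover of [K] by preimages of half-planes: near any
    point of [K], the values of [H] lie in one open half-plane bounded by a line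
    through [p], where crossings add up by [crossing_triangle]. *)
Lemma half_plane_cover (H : plane R -> plane R) K p :
  compact K -> {within K, continuous H} -> (forall z, K z -> H z != p) ->
  exists n : nat, forall z, K z -> exists w, forall z', K z' ->
    ball z n.+1%:R^-1 z' -> 0 < dot (H z' - p) w.
Proof.
move=> /compact_near_coveringP cK /subspace_continuousP cH Hp.
pose P (n : nat) z := exists w, forall z', K z' -> ball z n.+1%:R^-1 z' -> 0 < dot (H z' - p) w.
suff /(cK nat \oo P _) : forall z, K z -> \forall z' \near z & i \near \oo, P i z'.
  by case=> n _ /(_ n (leqnn n)) h; exists n => z Kz; exact: h.
move=> z Kz.
have d0 : 0 < dot (H z - p) (H z - p).
  rewrite lt_def addr_ge0 ?sqr_ge0 // andbT.
  apply: contraNneq (Hp z Kz) => /eqP.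
  rewrite /dot paddr_eq0 ?sqr_ge0 // !mulf_eq0 !orbb !subr_eq0 => /andP[/eqP e1 /eqP e2].
  exact/eqP/plane_eq.
have : \forall z' \near within K (nbhs z), 0 < dot (H z' - p) (H z - p).
  apply: cvgr_gt d0.
  exact: (cvg_comp _ _ (cH z Kz) (@dot_continuous p (H z - p) (H z))).
move=> /nbhs_ballP[e /= e0 he].
exists (ball z (e / 2), [set i : nat | i.+1%:R^-1 < e / 2]) => /=.
  split; first by apply: nbhsx_ballx; lra.
  have e20 : 0 < e / 2 by lra.
  exact: (near_infty_natSinv_lt (PosNum e20)).
move=> [z' i] /= [zz' ie]; exists (H z - p) => z'' Kz'' z'z''.
apply: he => //; apply: ball_split zz' _.
exact: le_ball (ltW ie) _ z'z''.
Qed.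

Lemma crossing_quad (a b c d w : plane R) :
  0 < dot a w -> 0 < dot b w -> 0 < dot c w -> 0 < dot d w ->
  crossing a b + crossing b d = crossing a c + crossing c d.
Proof.
move=> aw bw cw dw.
have := crossing_triangle (origin_off_dot aw bw dw).
have := crossing_triangle (origin_off_dot aw cw dw).
lra.
Qed.

(** Stokes on a grid: if no cell winds around the origin, the boundary of the
    whole grid does not either. *)
Lemma crossing_grid (G : nat -> nat -> plane R) N :
  (forall i j, (i < N)%N -> (j < N)%N -> exists w,
    [/\ 0 < dot (G i j) w, 0 < dot (G i j.+1) w,
        0 < dot (G i.+1 j) w & 0 < dot (G i.+1 j.+1) w]) ->
  \sum_(j < N) crossing (G 0 j) (G 0 j.+1) + \sum_(i < N) crossing (G i N) (G i.+1 N) =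
  \sum_(i < N) crossing (G i 0) (G i.+1 0) + \sum_(j < N) crossing (G N j) (G N j.+1).
Proof.
move=> cell.
have row i m : (i < N)%N -> (m <= N)%N ->
    \sum_(j < m) crossing (G i j) (G i j.+1) + crossing (G i m) (G i.+1 m) =
    crossing (G i 0) (G i.+1 0) + \sum_(j < m) crossing (G i.+1 j) (G i.+1 j.+1).
  move=> iN; elim: m => [|m IH] mN; first by rewrite !big_ord0 add0r addr0.
  have [w [? ? ? ?]] := cell i m iN mN.
  have quad : crossing (G i m) (G i m.+1) + crossing (G i m.+1) (G i.+1 m.+1) =
      crossing (G i m) (G i.+1 m) + crossing (G i.+1 m) (G i.+1 m.+1).
    exact: (@crossing_quad _ _ _ _ w).
  move: (IH (ltnW mN)); rewrite !big_ord_recr /=; lra.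
suff /(_ N (leqnn N)) : forall m, (m <= N)%N ->
  \sum_(j < N) crossing (G 0 j) (G 0 j.+1) + \sum_(i < m) crossing (G i N) (G i.+1 N) =
  \sum_(i < m) crossing (G i 0) (G i.+1 0) + \sum_(j < N) crossing (G m j) (G m j.+1) by [].
elim=> [|m IH] mN; first by rewrite !big_ord0 add0r addr0.
move: (IH (ltnW mN)) (row m N mN (leqnn N)); rewrite !big_ord_recr /=; lra.
Qed.

(** With values in the unit interval; sums of clamped affine functions give
    a polygonal path by one formula, whose continuity is clear. *)
Definition clamp (x : R) : R := Num.max 0 (Num.min x 1).

Lemma clamp_continuous : continuous clamp.
Proof.
move=> x.
apply: (@continuous_max R R^o (fun=> 0) (fun t => Num.min t 1)); first exact: cvg_cst.
by apply: (@continuous_min R R^o id (fun=> 1)); [exact: cvg_id|exact: cvg_cst].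
Qed.

(** The path through [y 0], ..., [y M] in this order, at times [k / M]. *)
Definition polyline (y : nat -> plane R) (M : nat) (t : R) : plane R :=
  y 0%N + \sum_(i < M) clamp (M%:R * t - i%:R) *: (y i.+1 - y i).

Lemma polyline_continuous y M : continuous (polyline y M).
Proof.
move=> t; apply: cvgD; first exact: cvg_cst.
have cv i : clamp (M%:R * s - i%:R) *: (y i.+1 - y i) @[s --> t] -->
            clamp (M%:R * t - i%:R) *: (y i.+1 - y i).
  apply: cvgZr_tmp.
  apply: (cvg_comp (fun s => M%:R * s - i%:R) clamp); last exact: clamp_continuous.
  by apply: cvgB; [apply: cvgMr; exact: cvg_id|exact: cvg_cst].
suff /(_ M) : forall m, \sum_(i < m) clamp (M%:R * s - i%:R) *: (y i.+1 - y i) @[s --> t] -->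
    \sum_(i < m) clamp (M%:R * t - i%:R) *: (y i.+1 - y i) by [].
elim=> [|m IH].
  by under eq_fun do rewrite big_ord0; rewrite big_ord0; exact: cvg_cst.
under eq_fun do rewrite big_ord_recr.
rewrite big_ord_recr /=; apply: cvgD => //; exact: cv.
Qed.

Lemma polylineE y M k (s : R) : (k < M)%N -> 0 <= s <= 1 ->
  polyline y M ((k%:R + s) / M%:R) = y k + s *: (y k.+1 - y k).
Proof.
move=> kM /andP[s0 s1].
have M0 : M%:R != 0 :> R by rewrite pnatr_eq0 -lt0n (leq_ltn_trans _ kM).
rewrite /polyline mulrC divfK //.
have -> : \sum_(i < M) clamp (k%:R + s - i%:R) *: (y i.+1 - y i) =
  \sum_(0 <= i < M) clamp (k%:R + s - i%:R) *: (y i.+1 - y i) by rewrite big_mkord.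
rewrite (big_cat_nat (leq0n k) (ltnW kM)) /= (big_ltn kM).
rewrite [X in _ + (_ + (_ + X))]big_nat_cond [X in _ + (_ + (_ + X))]big1 ?addr0; last first.
  move=> i /andP[/andP[ki _] _].
  have : k%:R + 1 <= i%:R :> R by rewrite natr1 ler_nat.
  move=> ki'; rewrite /clamp max_l ?scale0r // ge_min; apply/orP; left; lra.
have -> : clamp (k%:R + s - k%:R) = s.
  by rewrite addrAC subrr add0r /clamp min_l // max_r.
rewrite (eq_big_nat _ _ (F2 := fun i => y i.+1 - y i)); last first.
  move=> i /andP[_ ik].
  have : i%:R + 1 <= k%:R :> R by rewrite natr1 ler_nat.
  move=> ik'; rewrite /clamp min_r ?max_r ?scale1r //; lra.
by rewrite telescope_sumr // addrA subrKC.
Qed.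

Lemma nat_frac_decomp (M : nat) (x : R) : (0 < M)%N -> 0 <= x <= M%:R ->
  exists k s, [/\ (k < M)%N, 0 <= s <= 1 & x = k%:R + s].
Proof.
elim: M => // -[_ _|M IH _] /andP[x0 x1].
  by exists 0%N, x; rewrite x0 x1 add0r.
have [xM|xM] := leP x M.+1%:R.
  have [//||k [s [kM s01 ->]]] := IH; first by rewrite x0.
  by exists k, s; split => //; exact: ltnW.
exists M.+1, (x - M.+1%:R); split => //; last by lra.
by move: x1; rewrite -(natr1 M.+1) => ?; apply/andP; split; lra.
Qed.

(** A null-homotopy inside [Om] never meets [p]. On a fine enough grid each
    cell of its image lies in a half-plane avoiding [p], so the boundary of the
    grid has crossing sum zero; three sides are constant, and the fourth is a
    subdivision of the polygon. *)
Lemma closed_polyline_crossing (Om : set (plane R)) (p : plane R)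
    (y : nat -> plane R) (M : nat) :
  simply_connected Om -> ~ Om p -> y M = y 0%N ->
  (forall k (s : R), (k < M)%N -> 0 <= s <= 1 -> Om (y k + s *: (y k.+1 - y k))) ->
  \sum_(k < M) crossing (y k - p) (y k.+1 - p) = 0.
Proof.
move=> scOm pOm yM yOm.
have [->|M0] := posnP M; first by rewrite big_ord0.
have MR0 : 0 < M%:R :> R by rewrite ltr0n.
pose g := polyline y M.
have gk k (s : R) : (k < M)%N -> 0 <= s <= 1 ->
  g ((k%:R + s) / M%:R) = y k + s *: (y k.+1 - y k) by exact: polylineE.
have g0 : g 0 = y 0%N.
  have := gk 0%N 0 M0; rewrite lexx ler01 addr0 mul0r scale0r addr0; exact.
have g1 : g 1 = y 0%N.
  have := gk M.-1 1; rewrite ltn_predL M0 ler01 lexx natr1 prednK // => /(_ isT isT).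
  by rewrite divff ?gt_eqF // scale1r subrKC yM.
have gOm : g @` `[0, 1] `<=` Om.
  move=> x [t /=]; rewrite in_itv /= => /andP[t0 t1] <- {x}.
  have [//||k [s [kM s01 e]]] := @nat_frac_decomp M (t * M%:R).
    by rewrite mulr_ge0 //= ler_piMl.
  suff -> : g t = y k + s *: (y k.+1 - y k) by exact: yOm.
  by rewrite -gk // -e mulfK // gt_eqF.
have cg : {within `[0, 1], continuous g}.
  exact/continuous_subspaceT/polyline_continuous.
have [H [cH HOm Ht Hs]] := scOm g cg gOm (etrans g0 (esym g1)).
have cK : compact (`[0 : R, 1] `*` `[0 : R, 1]) by apply: compact_setX; exact: segment_compact.
have [|n hn] := half_plane_cover (p := p) cK cH.
  by move=> z Kz; apply: contra_notN pOm => /eqP <-; apply: HOm; exists z.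
(* [N] is a multiple of [M], so that the vertices of the polygon are grid points,
   and the mesh size [1 / N] is below the Lebesgue number [1 / n.+1]. *)
pose L := n.+2; pose N := (M * L)%N.
have N0 : 0 < N%:R :> R by rewrite ltr0n muln_gt0 M0.
pose gd (i : nat) : R := i%:R / N%:R.
have gd01 i : (i <= N)%N -> 0 <= gd i <= 1.
  by move=> iN; rewrite divr_ge0 //= ler_pdivrMr // mul1r ler_nat.
have gdN : gd N = 1 by rewrite /gd divff // gt_eqF.
have gd0 : gd 0%N = 0 by rewrite /gd mul0r.
pose G i j := H (gd i, gd j) - p.
have Kg i j : (i <= N)%N -> (j <= N)%N -> (`[0 : R, 1] `*` `[0 : R, 1]) (gd i, gd j).
  by move=> iN jN; split => /=; rewrite in_itv /= gd01.
have gdS i : ball (gd i) n.+1%:R^-1 (gd i.+1).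
  rewrite /ball /= /gd -mulrBl -natr1 opprD addNKr normrM normrN1 mul1r.
  rewrite ger0_norm ?invr_ge0 // ltf_pV2 ?posrE ?N0 ?ltr0n // ltr_nat.
  by rewrite /N /L (leq_trans (leqnn n.+2)) // leq_pmull.
have gdr i : ball (gd i) n.+1%:R^-1 (gd i) by apply: ballxx; rewrite invr_gt0 ltr0n.
have := @crossing_grid G N.
have e1 j : (j <= N)%N -> G 0%N j = g (gd j) - p.
  by move=> jN; rewrite /G gd0; have [] := Ht (gd j); rewrite ?in_itv /= ?gd01 // => ->.
have e2 j : (j <= N)%N -> G N j = g 0 - p.
  by move=> jN; rewrite /G gdN; have [] := Ht (gd j); rewrite ?in_itv /= ?gd01 // => _ ->.
have e3 i : (i <= N)%N -> G i 0%N = g 0 - p.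
  by move=> jN; rewrite /G gd0; have [] := Hs (gd i); rewrite ?in_itv /= ?gd01 // => ->.
have e4 i : (i <= N)%N -> G i N = g 0 - p.
  by move=> jN; rewrite /G gdN; have [] := Hs (gd i); rewrite ?in_itv /= ?gd01 // => _ ->.
rewrite [X in _ + X = _]big1 ?addr0; last first.
  by move=> i _; rewrite !e4 ?crossing_diag // ltnW.
rewrite [X in _ = X + _]big1 ?add0r; last first.
  by move=> i _; rewrite !e3 ?crossing_diag // ltnW.
rewrite [RHS]big1; last first.
  by move=> i _; rewrite !e2 ?crossing_diag // ltnW.
move=> boundary_sum.
have {boundary_sum} : \sum_(j < N) crossing (G 0%N j) (G 0%N j.+1) = 0.
  apply: boundary_sum => i j iN jN; have [w hw] := hn _ (Kg i j (ltnW iN) (ltnW jN)).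
  exists w; split; apply: hw; try (apply: Kg => //; exact: ltnW); split => //=.
rewrite (eq_bigr (fun j : 'I_N => crossing (g (gd j) - p) (g (gd j.+1) - p))); last first.
  by move=> j _; rewrite !e1 // ltnW.
have gdkl k l : (k < M)%N -> (l <= L)%N ->
    g (gd (k * L + l)%N) = y k + (l%:R / L%:R) *: (y k.+1 - y k).
  move=> kM lL; rewrite -gk //; last by rewrite divr_ge0 //= ler_pdivrMr ?ltr0n // mul1r ler_nat.
  congr g; rewrite /gd /N natrD !natrM; field.
  by rewrite gt_eqF //= pnatr_eq0.
have sub k l : (k < M)%N -> (l <= L)%N ->
    \sum_(j < k * L + l) crossing (g (gd j) - p) (g (gd j.+1) - p) =
    \sum_(j < k * L) crossing (g (gd j) - p) (g (gd j.+1) - p) +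
    crossing (y k - p) (g (gd (k * L + l)%N) - p).
  move=> kM; elim: l => [|l IH] lL.
    rewrite addn0 -[(k * L)%N in X in crossing _ X]addn0 gdkl // mul0r scale0r addr0.
    by rewrite crossing_diag addr0.
  rewrite addnS big_ord_recr /= IH 1?ltnW // -addrA; congr (_ + _).
  rewrite -addnS !gdkl //; last exact: ltnW.
  set a := y k - p; set b := y k + (l.+1%:R / L%:R) *: (y k.+1 - y k) - p.
  have -> : y k + (l%:R / L%:R) *: (y k.+1 - y k) - p = a + (l%:R / l.+1%:R) *: (b - a).
    have l1 : 1 + l%:R != 0 :> R by rewrite addrC natr1 pnatr_eq0.
    have L0 : L%:R != 0 :> R by rewrite pnatr_eq0.
    by apply: plane_eq; rewrite /a /b !planeE; field; rewrite l1 ?L0.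
  have oo : origin_off a (a + (l%:R / l.+1%:R) *: (b - a)) b.
    apply: origin_off_collinear.
      by rewrite divr_ge0 //= ler_pdivrMr ?ltr0n // mul1r ler_nat.
    move=> t /andP[t0 t1]; apply: contra_notN pOm => /eqP e.
    have : y k + (t * (l.+1%:R / L%:R)) *: (y k.+1 - y k) = p.
      apply/eqP; rewrite -subr_eq0 -e; apply/eqP.
      by apply: plane_eq; rewrite /a /b !planeE; ring.
    move=> <-; apply: yOm => //; rewrite mulr_ge0 //= mulr_ile1 //.
    by rewrite ler_pdivrMr ?ltr0n // mul1r ler_nat.
  by have := crossing_triangle oo; rewrite (crossing_anti a b); lra.
have tot k : (k <= M)%N ->
    \sum_(j < k * L) crossing (g (gd j) - p) (g (gd j.+1) - p) =
    \sum_(j < k) crossing (y j - p) (y j.+1 - p).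
  elim: k => [|k IH] kM; first by rewrite mul0n !big_ord0.
  rewrite mulSnr sub // IH 1?ltnW // big_ord_recr /=; congr (_ + crossing _ (_ - p)).
  by rewrite gdkl // divff ?pnatr_eq0 // scale1r subrKC.
by rewrite tot.
Qed.

End Winding.

(** * Potentials on finite graphs *)

Section Potential.
Context {R : realType} {I : finType} (r : rel I) (w : I -> I -> R).

Fixpoint walk_sum (x : I) (s : seq I) : R :=
  if s is y :: s' then w x y + walk_sum y s' else 0.

Lemma walk_sum_cat x s1 s2 :
  walk_sum x (s1 ++ s2) = walk_sum x s1 + walk_sum (last x s1) s2.
Proof. by elim: s1 x => [|y s1 IH] x /=; rewrite ?add0r // IH addrA. Qed.

Lemma walk_sumE d x s : walk_sum x s =
  \sum_(i < size s) w (nth d (x :: s) i) (nth d (x :: s) i.+1).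
Proof.
elim: s x => [|y s IH] x /=; first by rewrite big_ord0.
by rewrite big_ord_recl /= IH.
Qed.

(** Sum [w] along a path from a root of the component; two paths with the same
    end, each continued by the same way back to the root, give closed walks
    with equal sums. *)
Lemma closed_walk_potential : connect_sym r ->
  (forall x s, path r x s -> last x s = x -> walk_sum x s = 0) ->
  exists psi : I -> R, forall x y, r x y -> w x y = psi y - psi x.
Proof.
move=> symr closed.
have to x : exists s, path r (root r x) s /\ last (root r x) s = x.
  have : connect r (root r x) x by rewrite symr connect_root.
  by case/connectP=> s ? ?; exists s.
have fro x : exists s, path r x s /\ last x s = root r x.
  by have /connectP[s ? ?] := connect_root r x; exists s.
have [P hP] := choice to.
exists (fun x => walk_sum (root r x) (P x)) => x y xy.
have [[Px lx] [Py ly]] := (hP x, hP y).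
have rxy : root r y = root r x by apply/esym/(rootP symr)/connect1.
have [Q [Qy lQ]] := fro y.
have := closed (root r x) (P x ++ y :: Q).
rewrite cat_path last_cat walk_sum_cat lx Px /= xy Qy lQ rxy => /(_ isT erefl).
have := closed (root r y) (P y ++ Q).
rewrite cat_path last_cat walk_sum_cat ly Py /= Qy lQ => /(_ isT erefl).
rewrite rxy; lra.
Qed.

End Potential.

(** * Barycentric coordinates and hulls *)

Section Barycentric.
Context {R : realType}.
Implicit Types (A B C x w : plane R).

(** The coordinate at [A] of [x] in the triangle [A B C], by Cramer. *)
Definition bary A B C x : R := cross (B - x) (C - x) / cross (B - A) (C - A).

Lemma cross_rot A B C : cross (C - B) (A - B) = cross (B - A) (C - A).
Proof. by rewrite /cross !planeE; ring. Qed.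

Lemma bary_sum A B C x : cross (B - A) (C - A) != 0 ->
  bary A B C x + bary B C A x + bary C A B x = 1.
Proof.
move=> k; rewrite /bary (cross_rot C A B) (cross_rot B C A) (cross_rot A B C).
rewrite -!mulrDl; apply/eqP; rewrite -(inj_eq (mulIf k)) mul1r divfK //.
by rewrite /cross !planeE; apply/eqP; ring.
Qed.

Lemma bary_decomp A B C x : cross (B - A) (C - A) != 0 ->
  bary A B C x *: A + bary B C A x *: B + bary C A B x *: C = x.
Proof.
move=> k; rewrite /bary (cross_rot C A B) (cross_rot B C A) (cross_rot A B C).
move: k; rewrite /cross !planeE => k.
by apply: plane_eq; rewrite !planeE; field.
Qed.

Lemma baryE A B C (al be ga : R) : cross (B - A) (C - A) != 0 ->
  al + be + ga = 1 -> bary A B C (al *: A + be *: B + ga *: C) = al.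
Proof.
move=> k s; have -> : al = 1 - be - ga by rewrite -s; ring.
rewrite /bary; apply/eqP; rewrite -(inj_eq (mulIf k)) divfK //.
by rewrite /cross !planeE; apply/eqP; ring.
Qed.

Lemma bary_affine A B C x w (s : R) :
  bary A B C (x + s *: w) = bary A B C x + s * (bary A B C (x + w) - bary A B C x).
Proof. by rewrite /bary -!mulrBl mulrA -mulrDl; congr (_ / _); rewrite /cross !planeE; ring. Qed.

End Barycentric.

Section Hulls.
Context {R : realType} {P : finType} (pt : P -> plane R).

Lemma sum_support2 (V : nmodType) (f : P -> V) a b : a != b ->
  (forall i, i \notin [set a; b]%SET -> f i = 0) -> \sum_i f i = f a + f b.
Proof.
move=> ab f0; rewrite (bigD1 a) //= (bigD1 b) 1?eq_sym //= big1 ?addr0 // => i /andP[ia ib].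
by apply: f0; rewrite !inE negb_or ia ib.
Qed.

Lemma sum_support3 (V : nmodType) (f : P -> V) a b c : uniq [:: a; b; c] ->
  (forall i, i \notin [set a; b; c]%SET -> f i = 0) ->
  \sum_i f i = f a + f b + f c.
Proof.
rewrite /= !inE negb_or andbT => /andP[/andP[ab ac] bc] f0.
rewrite (bigD1 a) //= (bigD1 b) 1?eq_sym //= (bigD1 c) /=; last by rewrite eq_sym ac eq_sym bc.
rewrite big1 ?addr0 ?addrA // => i /andP[/andP[ia ib] ic].
by apply: f0; rewrite !inE !negb_or ia ib ic.
Qed.

Lemma ohull_hull (S : {set P}) : ohull pt S `<=` hull pt S.
Proof.
move=> x [w [w0 wS s e]]; exists w; split => // i.
by have [/w0/ltW|/wS ->] := boolP (i \in S).
Qed.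

Lemma hull2P a b x : a != b -> hull pt [set a; b]%SET x <->
  exists2 s : R, 0 <= s <= 1 & x = pt a + s *: (pt b - pt a).
Proof.
move=> ab; split.
  case=> w [w0 wS]; rewrite (sum_support2 ab wS) (sum_support2 ab) => [s ->|i iS]; last first.
    by rewrite wS // scale0r.
  exists (w b); first by rewrite w0 /= -s lerDr.
  have -> : w a = 1 - w b by rewrite -s addrK.
  by apply: plane_eq; rewrite !planeE; ring.
case=> s /andP[s0 s1] ->.
pose w i := if i == a then 1 - s else if i == b then s else 0.
have wS i : i \notin [set a; b]%SET -> w i = 0.
  by rewrite !inE negb_or /w => /andP[/negbTE -> /negbTE ->].
have wa : w a = 1 - s by rewrite /w eqxx.
have wb : w b = s by rewrite /w eq_sym (negbTE ab) eqxx.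
exists w; split => //.
- by move=> i; rewrite /w; case: ifP => _; [lra|case: ifP].
- by rewrite (sum_support2 ab wS) wa wb subrK.
- rewrite (sum_support2 ab) => [|i iS]; last by rewrite wS // scale0r.
  by rewrite wa wb; apply: plane_eq; rewrite !planeE; ring.
Qed.

Section Triangle.
Variables (a b c : P).
Hypothesis abc : uniq [:: a; b; c].
Hypothesis nondeg : cross (pt b - pt a) (pt c - pt a) != 0.
Local Notation T := [set a; b; c]%SET.

Lemma bary_weight (w : P -> R) : (forall i, i \notin T -> w i = 0) -> \sum_i w i = 1 ->
  [/\ w a = bary (pt a) (pt b) (pt c) (\sum_i w i *: pt i),
      w b = bary (pt b) (pt c) (pt a) (\sum_i w i *: pt i)
    & w c = bary (pt c) (pt a) (pt b) (\sum_i w i *: pt i)].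
Proof.
move=> wT; rewrite (sum_support3 abc wT) (sum_support3 abc) => [s|i iT]; last first.
  by rewrite wT // scale0r.
split; first by rewrite baryE.
  have -> : w a *: pt a + w b *: pt b + w c *: pt c =
      w b *: pt b + w c *: pt c + w a *: pt a by rewrite [RHS]addrC addrA.
  by rewrite baryE // 1?cross_rot // -s; ring.
have -> : w a *: pt a + w b *: pt b + w c *: pt c =
    w c *: pt c + w a *: pt a + w b *: pt b by rewrite [LHS]addrC addrA.
by rewrite baryE // -1?cross_rot // -s; ring.
Qed.

Let weight x i : R := if i == a then bary (pt a) (pt b) (pt c) x
  else if i == b then bary (pt b) (pt c) (pt a) x
  else if i == c then bary (pt c) (pt a) (pt b) x else 0.

Let weightP x : [/\ weight x a = bary (pt a) (pt b) (pt c) x,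
  weight x b = bary (pt b) (pt c) (pt a) x,
  weight x c = bary (pt c) (pt a) (pt b) x
  & forall i, i \notin T -> weight x i = 0].
Proof.
move: abc; rewrite /= !inE negb_or andbT => /andP[/andP[ab ac] bc].
rewrite /weight; split; rewrite ?eqxx //.
- by rewrite eq_sym (negbTE ab).
- by rewrite eq_sym (negbTE ac) eq_sym (negbTE bc).
- by move=> i; rewrite !inE !negb_or => /andP[/andP[/negbTE -> /negbTE ->] /negbTE ->].
Qed.

Let weight_sum x : \sum_i weight x i = 1.
Proof.
have [wa wb wc w0] := weightP x.
by rewrite (sum_support3 abc w0) wa wb wc bary_sum.
Qed.

Let weight_comb x : x = \sum_i weight x i *: pt i.
Proof.
have [wa wb wc w0] := weightP x.
rewrite (sum_support3 abc) => [|i iT]; last by rewrite w0 // scale0r.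
by rewrite wa wb wc bary_decomp.
Qed.

Lemma hull3P x : hull pt T x <->
  [/\ 0 <= bary (pt a) (pt b) (pt c) x, 0 <= bary (pt b) (pt c) (pt a) x
    & 0 <= bary (pt c) (pt a) (pt b) x].
Proof.
split=> [[w [w0 wT s ->]]|[ha hb hc]].
  by have [<- <- <-] := bary_weight wT s.
have [wa wb wc wT] := weightP x.
exists (weight x); split=> [i|//||]; [|exact: weight_sum|exact: weight_comb].
have [|/wT -> //] := boolP (i \in T).
by rewrite !inE => /orP[/orP[]|] /eqP ->; rewrite ?wa ?wb ?wc.
Qed.

Lemma ohull3P x : ohull pt T x <->
  [/\ 0 < bary (pt a) (pt b) (pt c) x, 0 < bary (pt b) (pt c) (pt a) x
    & 0 < bary (pt c) (pt a) (pt b) x].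
Proof.
split=> [[w [w0 wT s ->]]|[ha hb hc]].
  by have [<- <- <-] := bary_weight wT s; split; apply: w0; rewrite !inE eqxx ?orbT.
have [wa wb wc wT] := weightP x.
exists (weight x); split=> [i|//||]; [|exact: weight_sum|exact: weight_comb].
by rewrite !inE => /orP[/orP[]|] /eqP ->; rewrite ?wa ?wb ?wc.
Qed.

(** The weights are the barycentric coordinates of their sum. *)
Lemma weight_uniq (w w' : P -> R) :
  (forall i, i \notin T -> w i = 0) -> (forall i, i \notin T -> w' i = 0) ->
  \sum_i w i = 1 -> \sum_i w' i = 1 -> \sum_i w i *: pt i = \sum_i w' i *: pt i ->
  w =1 w'.
Proof.
move=> wT wT' s s' e i.
have [a1 b1 c1] := bary_weight wT s.
have [a2 b2 c2] := bary_weight wT' s'.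
have [|iT] := boolP (i \in T); last by rewrite wT // wT'.
by rewrite !inE => /orP[/orP[]|] /eqP ->; rewrite ?a1 ?b1 ?c1 e.
Qed.

End Triangle.
End Hulls.

(** * Faces and local covering of a triangulation *)

Section Rays.
Context {R : realType}.
Implicit Types (A B C x w : plane R).

Lemma ray_cvg x w : x + s *: w @[s --> (0 : R)^'+] --> x.
Proof.
apply: cvg_at_right_filter; rewrite -[X in _ --> X]addr0 -(scale0r w).
by apply: cvgD; [exact: cvg_cst|apply: cvgZr_tmp; exact: cvg_id].
Qed.

(** Barycentric coordinates are affine along a ray; strict inequalities at its
    origin hold nearby. *)
Lemma bary_ray_cvg A B C x w :
  bary A B C (x + s *: w) @[s --> (0 : R)^'+] --> bary A B C x.
Proof.
under eq_fun do rewrite bary_affine.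
apply: cvg_at_right_filter.
rewrite -[X in _ --> X]addr0 -[X in _ --> _ + X](mul0r (bary A B C (x + w) - bary A B C x)).
by apply: cvgD; [exact: cvg_cst|apply: cvgMl; exact: cvg_id].
Qed.

End Rays.

Section MeshGeometry.
Context {R : realType} {Om : set (plane R)} (M : triangulation Om).
Local Notation pt := (@pt R Om M).
Local Notation tris := (@tris R Om M).
Implicit Types (S T e : {set vert M}) (a b c i : vert M) (x y w : plane R).

Lemma tri_verticesP T a b : T \in tris -> a \in T -> b \in T -> a != b ->
  exists c, uniq [:: a; b; c] /\ T = [set a; b; c]%SET.
Proof.
move=> TM aT bT ab.
have T3 := tris_card TM.
have bTa : b \in (T :\ a)%SET by rewrite !inE eq_sym ab.
have : #|(T :\ a :\ b)%SET| == 1%N.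
  by move: (cardsD1 a T) (cardsD1 b (T :\ a)%SET); rewrite T3 aT bTa /= !add1n => -[<-] [<-].
case/cards1P => c Tc; exists c.
have cT : c \in (T :\ a :\ b)%SET by rewrite Tc inE.
split; last first.
  by rewrite -[LHS](finset.setD1K aT) -(finset.setD1K bTa) Tc finset.setUA.
move: cT; rewrite !inE => /andP[cb /andP[ca _]].
by rewrite /= !inE negb_or ab (eq_sym a) ca (eq_sym b) cb.
Qed.

Lemma tri_vertices T : T \in tris ->
  exists a b c, uniq [:: a; b; c] /\ T = [set a; b; c]%SET.
Proof.
move=> TM; have : (1 < #|T|)%N by rewrite (tris_card TM).
case/card_gt1P => a [b [aT bT ab]].
by have [c ?] := tri_verticesP TM aT bT ab; exists a, b, c.
Qed.

Lemma tri_nondeg a b c : [set a; b; c]%SET \in tris -> uniq [:: a; b; c] ->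
  cross (pt b - pt a) (pt c - pt a) != 0.
Proof. by move=> TM; apply: (tris_nondegenerate TM); rewrite !inE eqxx ?orbT. Qed.

Lemma tri_weight_uniq T (w w' : vert M -> R) : T \in tris ->
  (forall i, i \notin T -> w i = 0) -> (forall i, i \notin T -> w' i = 0) ->
  \sum_i w i = 1 -> \sum_i w' i = 1 -> \sum_i w i *: pt i = \sum_i w' i *: pt i ->
  w =1 w'.
Proof.
move=> TM; have [a [b [c [u eT]]]] := tri_vertices TM; rewrite eT in TM *.
exact: weight_uniq (tri_nondeg TM u) _ _.
Qed.

(** A relative interior point of a face [S] determines [S]: by conformity
    the point has weights supported on [T :&: T'], which agree with those on
    [S] and with those on [S'] by uniqueness of barycentric coordinates. *)
Lemma ohull_hull_face S T S' T' x :
  T \in tris -> T' \in tris -> S \subset T -> S' \subset T' ->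
  ohull pt S x -> hull pt S' x -> S \subset S'.
Proof.
move=> TM TM' ST ST' [w [w0 wS ws xw]] [w' [w0' wS' ws' xw']].
have wT i : i \notin T -> w i = 0.
  by move=> iT; apply/wS; apply: contra iT; exact/fintype.subsetP.
have wT' i : i \notin T' -> w' i = 0.
  by move=> iT; apply/wS'; apply: contra iT; exact/fintype.subsetP.
have hT : hull pt T x.
  by exists w; split=> // i; have [/w0/ltW|/wS ->] := boolP (i \in S).
have hT' : hull pt T' x by exists w'; split.
have : hull pt (T :&: T')%SET x by rewrite -(tris_conforming TM TM').
case=> v [v0 vT vs xv].
have vw : v =1 w.
  apply: (tri_weight_uniq TM) => //; last by rewrite -xv.
  by move=> i iT; apply: vT; rewrite inE (negbTE iT).
have vw' : v =1 w'.
  apply: (tri_weight_uniq TM') => //; last by rewrite -xv.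
  by move=> i iT; apply: vT; rewrite inE (negbTE iT) andbF.
apply/fintype.subsetP => i iS; have := w0 i iS; rewrite -vw vw'.
by apply: contraTT => /wS' ->; rewrite ltxx.
Qed.

(** Hulls are closed and finite in number: a triangle that misses [x] also
    misses the points near [x], so the triangles covering the beginning of the
    ray contain [x]. *)
Lemma ray_cover x w : open Om -> Om x ->
  \forall s \near (0 : R)^'+, exists2 T, T \in tris &
    hull pt T x /\ hull pt T (x + s *: w).
Proof.
move=> oOm Ox.
have near_Om : \forall s \near (0 : R)^'+, Om (x + s *: w).
  exact: (@ray_cvg _ x w) (open_nbhs_nbhs (conj oOm Ox)).
have near_T : \forall s \near (0 : R)^'+, forall T, T \in tris ->
    ~ hull pt T x -> ~ hull pt T (x + s *: w).
  apply: filter_forall => T.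
  have [TM|TM] := boolP (T \in tris); last by near=> s.
  have [hx|hx] := pselect (hull pt T x); first by near=> s.
  have [a [b [c [u eT]]]] := tri_vertices TM; rewrite eT in TM hx *.
  have nd := tri_nondeg TM u.
  suff [A [B [C [h0 hh]]]] : exists A B C, bary A B C x < 0 /\
      forall y, hull pt [set a; b; c]%SET y -> 0 <= bary A B C y.
    have sx := cvgr_lt _ (@bary_ray_cvg _ A B C x w) _ h0.
    near=> s => _ _ /hh; rewrite leNgt => /negP; apply; near: s; exact: sx.
  have [h1|h1] := ltP (bary (pt a) (pt b) (pt c) x) 0.
    by exists (pt a), (pt b), (pt c); split => // y /(hull3P u nd) [].
  have [h2|h2] := ltP (bary (pt b) (pt c) (pt a) x) 0.
    by exists (pt b), (pt c), (pt a); split => // y /(hull3P u nd) [].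
  have [h3|h3] := ltP (bary (pt c) (pt a) (pt b) x) 0.
    by exists (pt c), (pt a), (pt b); split => // y /(hull3P u nd) [].
  by case: hx; apply/(hull3P u nd).
near=> s.
have : closure Om (x + s *: w) by apply: subset_closure; near: s.
rewrite -(tris_cover M) => -[T /= TM hT]; exists T => //; split => //.
by apply: contrapT => hx; exact: (near near_T s) hT.
Unshelve. all: by end_near. Qed.

Definition centroid T : plane R := \sum_(i in T) 3^-1 *: pt i.
Definition midpoint e : plane R := \sum_(i in e) 2^-1 *: pt i.

Lemma centroid3 a b c : uniq [:: a; b; c] ->
  centroid [set a; b; c]%SET = 3^-1 *: pt a + 3^-1 *: pt b + 3^-1 *: pt c.
Proof.
move=> u; rewrite /centroid big_mkcond /= (sum_support3 u) => [|i /negbTE -> //].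
by rewrite !inE !eqxx ?orbT.
Qed.

Lemma midpoint2 a b : a != b ->
  midpoint [set a; b]%SET = pt a + 2^-1 *: (pt b - pt a).
Proof.
move=> u; rewrite /midpoint big_mkcond /= (sum_support2 u) => [|i /negbTE -> //].
rewrite !inE !eqxx ?orbT.
by apply: plane_eq; rewrite !planeE; field.
Qed.

Lemma centroid_ohull T : T \in tris -> ohull pt T (centroid T).
Proof.
move=> TM; exists (fun i => if i \in T then 3^-1 else 0); split.
- by move=> i ->; lra.
- by move=> i /negbTE ->.
- by rewrite -big_mkcond /= sumr_const tris_card // -[LHS]mulr_natr mulVf.
- by rewrite /centroid big_mkcond; apply: eq_bigr => i _; case: ifP; rewrite ?scale0r.
Qed.

Lemma midpoint_ohull e : #|e| = 2%N -> ohull pt e (midpoint e).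
Proof.
move=> e2; exists (fun i => if i \in e then 2^-1 else 0); split.
- by move=> i ->; lra.
- by move=> i /negbTE ->.
- by rewrite -big_mkcond /= sumr_const e2 // -[LHS]mulr_natr mulVf.
- by rewrite /midpoint big_mkcond; apply: eq_bigr => i _; case: ifP; rewrite ?scale0r.
Qed.

Lemma ohull_segment T e x y (s : R) : e \subset T -> ohull pt T x -> hull pt e y ->
  0 <= s < 1 -> ohull pt T (x + s *: (y - x)).
Proof.
move=> eT [w [w0 wT ws ->]] [v [v0 ve vs ->]] /andP[s0 s1].
exists (fun i => (1 - s) * w i + s * v i); split.
- move=> i /w0 wi; have := v0 i; nra.
- by move=> i iT; rewrite wT // ve ?mulr0 ?addr0 //; apply: contra iT; exact/fintype.subsetP.
- by rewrite big_split /= -!mulr_sumr ws vs !mulr1 subrK.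
- under [RHS]eq_bigr do rewrite scalerDl -!scalerA.
  rewrite big_split /= -!scaler_sumr.
  by apply: plane_eq; rewrite !planeE; ring.
Qed.

Lemma vertex_ohull i : ohull pt [set i]%SET (pt i).
Proof.
exists (fun j => (j == i)%:R); split.
- by move=> j; rewrite inE => /eqP ->; rewrite eqxx.
- by move=> j; rewrite inE => /negbTE ->.
- by rewrite (bigD1 i) //= eqxx big1 ?addr0 // => j /negbTE ->.
- by rewrite (bigD1 i) //= eqxx scale1r big1 ?addr0 // => j /negbTE ->; rewrite scale0r.
Qed.

Lemma vertex_hull S i : i \in S -> hull pt S (pt i).
Proof.
move=> iS; have [w [w0 wi ws e]] := ohull_hull (vertex_ohull i).
exists w; split => // j jS; apply: wi; rewrite inE.
by apply: contraNneq jS => ->.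
Qed.

End MeshGeometry.

(** * The two triangles at an interior edge *)

Section EdgeSides.
Context {R : realType} {Om : set (plane R)} (M : triangulation Om).
Hypothesis oOm : open Om.
Local Notation pt := (@pt R Om M).
Local Notation tris := (@tris R Om M).
Local Notation cen T := (centroid (val T)).
Local Notation mid e := (midpoint (val e)).
Implicit Types (T : triangle M) (e : edge M) (a b c p : vert M) (w : plane R).

Definition perp (u : plane R) : plane R := (- u.2, u.1).

Lemma cross_perp (u : plane R) : cross u (perp u) = dot u u.
Proof. by rewrite /dot /cross /=; ring. Qed.

Lemma dot_gt0 (u : plane R) : u != 0 -> 0 < dot u u.
Proof.
move=> u0; rewrite lt_def addr_ge0 ?sqr_ge0 // andbT.
apply: contra_neq u0; rewrite /dot => /eqP.
by rewrite paddr_eq0 ?sqr_ge0 // !mulf_eq0 !orbb => /andP[/eqP ? /eqP ?]; apply: plane_eq.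
Qed.

Lemma pt_neq a b : a != b -> pt b - pt a != 0.
Proof. by apply: contra_neq => /eqP; rewrite subr_eq0 => /eqP /pt_inj. Qed.

Lemma edge_card e : #|val e| = 2%N.
Proof. by have /andP[/eqP] := valP e. Qed.

Lemma edge_vertices e : exists a b, a != b /\ val e = [set a; b]%SET.
Proof. by have /eqP/cards2P[a [b [? ?]]] := edge_card e; exists a, b. Qed.

Lemma edge_triangle e : exists T, val e \subset val T.
Proof. by have /andP[_ /existsP[T /andP[TM eT]]] := valP e; exists (Sub T TM). Qed.

Lemma edge_in_triangle e T a b : val e = [set a; b]%SET -> a != b -> val e \subset val T ->
  exists c, [/\ uniq [:: a; b; c], val T = [set a; b; c]%SET
    & cross (pt b - pt a) (pt c - pt a) != 0].
Proof.
move=> ee ab; rewrite ee finset.subUset !finset.sub1set => /andP[aT bT].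
have [c [u eT]] := tri_verticesP (valP T) aT bT ab.
exists c; split => //; apply: tri_nondeg => //; by rewrite -eT (valP T).
Qed.

Lemma interior_edge_sub e : interior_edge e -> ohull pt (val e) `<=` Om.
Proof.
move=> /asboolPn ie; have [T eT] := edge_triangle e.
by have [//|/ie] := edges_resolved (valP T) eT (edge_card e).
Qed.

Lemma mid_ohull e : ohull pt (val e) (mid e).
Proof. exact/midpoint_ohull/edge_card. Qed.

Lemma cross_centroid a b c : uniq [:: a; b; c] ->
  cross (pt b - pt a) (centroid [set a; b; c]%SET - pt a) =
  3^-1 * cross (pt b - pt a) (pt c - pt a).
Proof. by move=> u; rewrite centroid3 // /cross !planeE; field. Qed.

Lemma centroid_side_neq0 e T a b : val e = [set a; b]%SET -> a != b ->
  val e \subset val T -> cross (pt b - pt a) (cen T - pt a) != 0.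
Proof.
move=> ee ab eT; have [c [u -> nd]] := edge_in_triangle ee ab eT.
by rewrite cross_centroid // mulf_neq0 // invr_eq0.
Qed.

(** Points just beyond the midpoint in direction [w] are in [Om], hence in a
    triangle which contains the midpoint ([ray_cover]), and therefore the edge. *)
Lemma side_exists e a b w : interior_edge e -> val e = [set a; b]%SET -> a != b ->
  cross (pt b - pt a) w != 0 ->
  exists T, val e \subset val T /\
    0 < cross (pt b - pt a) (cen T - pt a) * cross (pt b - pt a) w.
Proof.
move=> ie ee ab w0.
have Om_m : Om (mid e) := interior_edge_sub ie (mid_ohull e).
have [s] := filter_ex (filterI (nbhs_right_gt (0 : R)) (ray_cover M w oOm Om_m)).
move=> [/= s0 [T TM [hm hs]]].
have [T0 eT0] := edge_triangle e.
have eT : val e \subset T.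
  exact: (ohull_hull_face (valP T0) TM eT0 (subxx _) (mid_ohull e) hm).
exists (Sub T TM); rewrite SubK; split => //.
have [c [u eT' nd]] := @edge_in_triangle e (Sub T TM) a b ee ab eT.
rewrite SubK in eT'; rewrite eT' cross_centroid //.
move: hs; rewrite eT' => /(hull3P u nd)[_ _].
rewrite /bary (cross_rot (pt b) (pt c)) (cross_rot (pt a) (pt b)) ee midpoint2 //.
have -> : cross (pt a - (pt a + 2^-1 *: (pt b - pt a) + s *: w))
  (pt b - (pt a + 2^-1 *: (pt b - pt a) + s *: w)) = s * cross (pt b - pt a) w.
  by rewrite /cross !planeE; field.
set K := cross _ (pt c - _) in nd *; set W := cross _ w in w0 *.
move=> h.
have : 0 <= K * W.
  have -> : K * W = s * W / K * (K * K / s) by field; rewrite nd gt_eqF.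
  by rewrite mulr_ge0 // divr_ge0 -?expr2 ?sqr_ge0 ?(ltW s0).
rewrite le_eqVlt eq_sym mulf_eq0 (negbTE nd) (negbTE w0) /=.
by move=> ?; rewrite -mulrA mulr_gt0.
Qed.

(** Going from the midpoint of the edge towards the centroid of [T], one is in the
    interior of [T], and at first also in [T'], since only the coordinate of [T']
    opposite to the edge vanishes at the midpoint and it increases. By
    [ohull_hull_face] the triangles coincide. *)
Lemma side_uniq e T T' a b : val e = [set a; b]%SET -> a != b ->
  val e \subset val T -> val e \subset val T' ->
  0 < cross (pt b - pt a) (cen T - pt a) * cross (pt b - pt a) (cen T' - pt a) -> T = T'.
Proof.
move=> ee ab eT eT'.
have [c [u ET nd]] := edge_in_triangle ee ab eT.
have [c' [u' ET' nd']] := edge_in_triangle ee ab eT'.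
rewrite ET' (cross_centroid u') => same.
set m := mid e; set w := cen T - m.
have em : m = pt a + 2^-1 *: (pt b - pt a) by rewrite /m ee midpoint2.
(* At the midpoint the coordinates of [T'] at [a] and [b] are [1 / 2]. *)
have m1 : 0 < bary (pt a) (pt b) (pt c') m.
  suff -> : bary (pt a) (pt b) (pt c') m = 2^-1 by lra.
  by move: nd'; rewrite em /bary /cross !planeE => nd'; field.
have m2 : 0 < bary (pt b) (pt c') (pt a) m.
  suff -> : bary (pt b) (pt c') (pt a) m = 2^-1 by lra.
  by move: nd'; rewrite em /bary (cross_rot (pt a) (pt b)) /cross !planeE => nd'; field.
have [s [/= s0 [s1 [h1 h2]]]] := filter_ex (filterI (nbhs_right_gt (0 : R))
  (filterI (nbhs_right_lt (ltr01 : (0 : R) < 1))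
  (filterI (cvgr_gt _ (@bary_ray_cvg _ _ _ _ _ w) _ m1)
           (cvgr_gt _ (@bary_ray_cvg _ _ _ _ _ w) _ m2)))).
have hT : ohull pt (val T) (m + s *: w).
  have -> : m + s *: w = cen T + (1 - s) *: (m - cen T).
    by rewrite /w; apply: plane_eq; rewrite !planeE; ring.
  apply: (ohull_segment eT); [exact/centroid_ohull/(valP T)|exact/ohull_hull/mid_ohull|].
  by apply/andP; split; lra.
have hT' : hull pt (val T') (m + s *: w).
  rewrite ET'; apply/(hull3P u' nd'); split; rewrite ?ltW //.
  rewrite /bary (cross_rot (pt b) (pt c')) (cross_rot (pt a) (pt b)).
  have -> : cross (pt a - (m + s *: w)) (pt b - (m + s *: w)) = s * cross (pt b - pt a) (cen T - pt a).
    by rewrite /w em /cross !planeE; field.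
  set K := cross _ (cen T - _) in same *; set K' := cross _ (pt c' - _) in nd' same *.
  have -> : s * K / K' = s * (K * (3^-1 * K')) * 3 / (K' * K') by field.
  apply: divr_gt0; first by rewrite mulr_gt0 // mulr_gt0.
  by rewrite lt_def mulf_neq0 // -expr2 sqr_ge0.
have TT' := ohull_hull_face (valP T) (valP T') (subxx _) (subxx _) hT hT'.
by apply/val_inj/eqP; rewrite eqEcard TT' !tris_card // ?(valP T) ?(valP T').
Qed.

Lemma interior_edge_sides e a b : interior_edge e -> val e = [set a; b]%SET -> a != b ->
  exists TL TR : triangle M, [/\ val e \subset val TL, val e \subset val TR,
    0 < cross (pt b - pt a) (cen TL - pt a),
    cross (pt b - pt a) (cen TR - pt a) < 0
  & forall T, val e \subset val T -> T = TL \/ T = TR].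
Proof.
move=> ie ee ab; set u := pt b - pt a.
have uu : 0 < cross u (perp u) by rewrite cross_perp dot_gt0 // pt_neq.
have uN : cross u (- perp u) = - cross u (perp u) by rewrite /cross /=; ring.
have [|TL [eL L0]] := @side_exists e a b (perp u) ie ee ab; first by rewrite gt_eqF.
have [|TR [eR R0]] := @side_exists e a b (- perp u) ie ee ab; first by rewrite uN oppr_eq0 gt_eqF.
rewrite pmulr_lgt0 // in L0.
rewrite uN mulrN oppr_gt0 pmulr_llt0 // in R0.
exists TL, TR; split=> // T eT.
have := centroid_side_neq0 ee ab eT; rewrite neq_lt -/u => /orP[T0|T0].
  by right; apply: (side_uniq ee ab) => //; rewrite nmulr_rgt0.
by left; apply: (side_uniq ee ab) => //; rewrite pmulr_rgt0.
Qed.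

Lemma interior_vertex_Om p : interior_vertex p -> Om (pt p).
Proof.
case/andP=> /existsP[T /andP[TM pT]] /asboolPn nb.
suff : closure Om (pt p).
  by move=> cp; apply: contrapT => np; apply: nb; split => // /interior_subset.
by rewrite -(tris_cover M); exists T => //; exact: vertex_hull.
Qed.

Lemma boundary_vertex_notin p T : p \in val T -> ~~ interior_vertex p -> ~ Om (pt p).
Proof.
move=> pT; rewrite negb_and => /orP[/existsPn/(_ (val T))|]; first by rewrite pT (valP T).
rewrite negbK => /asboolP[_ np] Op; apply: np.
exact: (open_nbhs_nbhs (conj oOm Op)).
Qed.

Lemma interior_vertex_edge p e : interior_vertex p -> p \in val e -> interior_edge e.
Proof.
case/andP=> _ /asboolPn nb pe; apply/asboolPn => eb; apply: nb; apply: eb.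
exact: vertex_hull.
Qed.

(** The triangles at an interior vertex surround it: every direction enters one. *)
Lemma vertex_ray_cover p w : interior_vertex p ->
  exists (s : R) T, [/\ 0 < s, p \in val T & hull pt (val T) (pt p + s *: w)].
Proof.
move=> ip; have Op := interior_vertex_Om ip.
have [s] := filter_ex (filterI (nbhs_right_gt (0 : R)) (ray_cover M w oOm Op)).
move=> [/= s0 [T TM [hm hs]]].
exists s, (Sub T TM); rewrite SubK; split => //.
case/andP: ip => /existsP[T0 /andP[TM0 pT0]] _.
have : [set p]%SET \subset T.
  by apply: (ohull_hull_face TM0 TM _ (subxx _) (vertex_ohull p)) => //; rewrite finset.sub1set.
by rewrite finset.sub1set.
Qed.

End EdgeSides.

(** * Areas and the weak divergence *)

Section SimpleIntegral.
Context {d : measure_display} {T : measurableType d} {R : realType}.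
Variable mu : {measure set T -> \bar R}.

(** The sets [A i] lie in [D], so that the integral is one over the whole space. *)
Lemma Rintegral_sum_indic (I : finType) (A : I -> set T) (D : set T) (q : I -> R) :
  (forall i, measurable (A i)) -> (forall i, (mu (A i) < +oo)%E) ->
  (forall i, A i `<=` D) ->
  \int[mu]_(x in D) (\sum_i q i * \1_(A i) x) = \sum_i q i * fine (mu (A i)).
Proof.
move=> mA fA AD; rewrite Rintegral_mkcond.
have -> : (fun x => \sum_i q i * \1_(A i) x) \_ D = (fun x => \sum_i q i * \1_(A i) x).
  apply/funext => x; rewrite patchE; case: ifPn => // xD.
  rewrite big1 // => i _; rewrite indicE memNset ?mulr0 // => /AD xi.
  by move: xD; rewrite notin_setE.
have iA i : mu.-integrable setT (fun x => (\1_(A i) x)%:E).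
  apply/integrableP; split; first exact/measurable_EFinP/measurable_indic.
  under eq_integral do rewrite gee0_abs ?lee_fin //.
  by rewrite integral_indic // setIT.
rewrite /Rintegral.
under eq_integral do rewrite -sumEFin.
rewrite (integral_sum _ (f := fun i x => (q i * \1_(A i) x)%:E)) //; last first.
  by move=> i; under eq_fun do rewrite EFinM; exact: integrableZl.
rewrite (eq_bigr (fun i => (q i * fine (mu (A i)))%:E)) ?sumEFin // => i _.
under eq_integral do rewrite EFinM.
by rewrite integralZl // integral_indic // setIT EFinM fineK // ge0_fin_numE.
Qed.

End SimpleIntegral.

Section Area.
Context {R : realType} {P : finType} (pt : P -> plane R).

Lemma bary_expand (A B C : plane R) : exists c0 c1 c2 : R,
  bary A B C = (fun x => c0 + c1 * x.1 + c2 * x.2).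
Proof.
pose K := (cross (B - A) (C - A))^-1.
exists (cross B C * K), ((B.2 - C.2) * K), ((C.1 - B.1) * K).
by apply/funext => x; rewrite /bary -/K /cross !planeE; ring.
Qed.

Lemma bary_gt0_measurable (A B C : plane R) :
  measurable ([set x | 0 < bary A B C x] : set (measurableTypeR R * measurableTypeR R)).
Proof.
have [c0 [c1 [c2 ->]]] := bary_expand A B C.
have mf : measurable_fun setT
    (fun x : measurableTypeR R * measurableTypeR R => c0 + c1 * x.1 + c2 * x.2).
  apply: measurable_funD; first apply: measurable_funD => //.
    by apply: measurable_funM => //; exact: measurable_fst.
  by apply: measurable_funM => //; exact: measurable_snd.
have := mf measurableT _ (measurable_itv `]0, +oo[).
rewrite setTI; congr measurable; apply/funext => x /=.
by rewrite in_itv /= andbT.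
Qed.

(** A square that contains the hull; it bounds the area of a triangle. *)
Lemma hull_bounded (S : {set P}) : exists B : R, hull pt S `<=` `[- B, B] `*` `[- B, B].
Proof.
exists (\sum_i (`|(pt i).1| + `|(pt i).2|)) => x [w [w0 wS ws ->]].
have w1 i : w i <= 1.
  by rewrite -ws (bigD1 i) //= lerDl sumr_ge0.
have bd (g : plane R -> R) : (forall y z, g (y + z) = g y + g z) ->
   (forall (k : R) y, g (k *: y) = k * g y) -> g 0 = 0 ->
   (forall y, `|g y| <= `|y.1| + `|y.2|) ->
   `|g (\sum_i w i *: pt i)| <= \sum_i (`|(pt i).1| + `|(pt i).2|).
  move=> gD gZ g0 gn.
  rewrite (big_morph g gD g0) (le_trans (ler_norm_sum _ _ _)) // ler_sum // => i _.
  rewrite gZ normrM ger0_norm // (le_trans _ (gn _)) //.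
  by rewrite -[leRHS]mul1r ler_wpM2r.
by split => /=; rewrite in_itv /= -ler_norml; apply: bd => //= y; rewrite ?lerDl ?lerDr.
Qed.

End Area.

Lemma lebesgue2_box {R : realType} (i j : interval R) :
  lebesgue2 ([set` i] `*` [set` j]) =
  (@lebesgue_measure R [set` i] * @lebesgue_measure R [set` j])%E.
Proof. by apply: product_measure1E; exact: measurable_itv. Qed.

Section MeshArea.
Context {R : realType} {Om : set (plane R)} (M : triangulation Om).
Local Notation pt := (@pt R Om M).
Implicit Types (T : triangle M) (v : Vh M).

Lemma ohull_measurable T :
  measurable (ohull pt (val T) : set (measurableTypeR R * measurableTypeR R)).
Proof.
have [a [b [c [u eT]]]] := tri_vertices (valP T).
have nd : cross (pt b - pt a) (pt c - pt a) != 0.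
  by apply: tri_nondeg => //; rewrite -eT (valP T).
have -> : ohull pt (val T) = [set x | 0 < bary (pt a) (pt b) (pt c) x] `&`
   [set x | 0 < bary (pt b) (pt c) (pt a) x] `&` [set x | 0 < bary (pt c) (pt a) (pt b) x].
  rewrite eT; apply/seteqP; split => x /=; first by move/(ohull3P u nd) => [].
  by move=> [[h1 h2] h3]; apply/(ohull3P u nd).
by apply: measurableI; [apply: measurableI|]; exact: bary_gt0_measurable.
Qed.

Lemma ohull_measure_lt T : (@lebesgue2 R (ohull pt (val T)) < +oo)%E.
Proof.
have [B hB] := hull_bounded pt (val T).
apply: (@le_lt_trans _ _ (lebesgue2 (`[- B, B] `*` `[- B, B]))).
  apply: le_measure; rewrite ?inE.
  - exact: ohull_measurable.
  - by apply: measurableX; exact: measurable_itv.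
  - by apply: subset_trans hB; exact: ohull_hull.
rewrite lebesgue2_box.
by rewrite lebesgue_measure_itv /=; case: ifP => _; rewrite ?mule0 // -EFinB -EFinM ltry.
Qed.

Lemma ohull_measure_gt0 T : (0 < @lebesgue2 R (ohull pt (val T)))%E.
Proof.
have [a [b [c [u eT]]]] := tri_vertices (valP T).
have nd : cross (pt b - pt a) (pt c - pt a) != 0.
  by apply: tri_nondeg => //; rewrite -eT (valP T).
have := centroid_ohull (valP T); set x := centroid _; rewrite {1}eT.
move=> /(ohull3P u nd)[h1 h2 h3].
have cb (A B C : plane R) : continuous (bary A B C).
  have [c0 [c1 [c2 ->]]] := bary_expand A B C => y.
  apply: cvgD; first apply: cvgD; first exact: cvg_cst.
    by apply: cvgMr; exact: cvg_fst.
  by apply: cvgMr; exact: cvg_snd.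
have n1 := @cvgr_gt _ _ _ (nbhs_filter x) _ _ (cb _ _ _ x) _ h1.
have n2 := @cvgr_gt _ _ _ (nbhs_filter x) _ _ (cb _ _ _ x) _ h2.
have n3 := @cvgr_gt _ _ _ (nbhs_filter x) _ _ (cb _ _ _ x) _ h3.
have [e /= e0 he] := (nbhs_ballP _ _).1 (filterI n1 (filterI n2 n3)).
pose bx (t : R) := `[t - e / 2, t + e / 2]%classic.
apply: (@lt_le_trans _ _ (lebesgue2 (bx x.1 `*` bx x.2))).
  have t2 (t : R) : t - e / 2 < t + e / 2 by lra.
  rewrite lebesgue2_box !lebesgue_measure_itv /= !lte_fin !t2.
  by rewrite -!EFinB -EFinM lte_fin mulr_gt0 //; lra.
apply: le_measure; rewrite ?inE.
- by apply: measurableX; exact: measurable_itv.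
- exact: ohull_measurable.
- move=> y [/=]; rewrite /bx /= !in_itv /= => /andP[? ?] /andP[? ?].
  have [|? [? ?]] := he y; last by rewrite eT; apply/(ohull3P u nd).
  by split => /=; rewrite /ball /= ltr_norml; apply/andP; split; lra.
Qed.

Definition area T : R := fine (@lebesgue2 R (ohull pt (val T))).

Lemma area_gt0 T : 0 < area T.
Proof. by rewrite fine_gt0 // ohull_measure_gt0 ohull_measure_lt. Qed.

Lemma inner_tri_cst T (k l : R) : inner_tri T (cst k) (cst l) = k * l * area T.
Proof. exact: (Rintegral_cst lebesgue2 (ohull_measurable T) (k * l)). Qed.

Lemma inner_tri_grad_cst T u (k : R) : inner_tri_grad T u (cst k) = 0.
Proof.
rewrite /inner_tri_grad (@eq_Rintegral _ _ _ _ _ (cst 0)).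
  by rewrite (Rintegral_cst lebesgue2 (ohull_measurable T) 0) mul0r.
by move=> x _; rewrite !derive_cst /dot /= !mulr0 addr0.
Qed.

Lemma WhP (q : triangle M -> R) : Wh M q <-> \sum_T q T * area T = 0.
Proof.
rewrite /Wh /= /pw_const Rintegral_sum_indic //.
- by move=> T; exact: ohull_measurable.
- by move=> T; exact: ohull_measure_lt.
- by move=> T; apply: tris_inside (valP T).
Qed.

(** The integral of the outward normal component of [v] over the edge. *)
Definition flow v T (e : edge M) : R :=
  edge_length e * dot (boundary_part v e) (outward_normal T e).

Definition net_flow v T : R := \sum_(e : edge M | val e \subset val T) flow v T e.

Lemma flux_cst v T (k : R) : flux v T (cst k) = k * net_flow v T.
Proof.
rewrite /flux /net_flow mulr_sumr; apply: eq_bigr => e _.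
rewrite /edge_integral /flow /edge_length.
have int01 (l : R) : \int[@lebesgue_measure R]_(t in `[0, 1]) l = l.
  have m01 : fine (@lebesgue_measure R `[0, 1]) = 1.
    by rewrite lebesgue_measure_itv /= lte_fin ltr01 oppr0 addr0.
  apply: etrans (_ : l * fine (@lebesgue_measure R `[0, 1]) = l).
    exact: (Rintegral_cst (@lebesgue_measure R) (measurable_itv `[0, 1]) l).
  by rewrite m01 mulr1.
case: (enum _) => [|a [|b [|? ?]]]; rewrite ?mul0r ?mulr0 //.
apply: etrans (int01 (dot (boundary_part v e) (k *: outward_normal T e) * enorm (pt b - pt a))) _.
by rewrite /dot !planeE; ring.
Qed.

(** On constants the gradient term vanishes, so the defining relation of
    the weak divergence reads as below, and the area is nonzero. *)
Lemma weak_divE v T : weak_div v T * area T = net_flow v T.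
Proof.
have a0 : area T != 0 by rewrite gt_eqF // area_gt0.
pose Q := [set k : R | forall c : R, inner_tri T (cst k) (cst c) =
  - inner_tri_grad T (cst (interior_part v T)) (cst c) + flux v T (cst c)].
have : Q (net_flow v T / area T).
  by move=> c; rewrite inner_tri_cst inner_tri_grad_cst flux_cst oppr0 add0r; field.
move=> /getI /(_ 1).
by rewrite inner_tri_cst inner_tri_grad_cst flux_cst oppr0 add0r mulr1 mul1r.
Qed.

Lemma bformE v q : bform v q = \sum_T q T * net_flow v T.
Proof.
apply: eq_bigr => T _; rewrite inner_tri_cst -weak_divE; ring.
Qed.

(** Testing with functions of mean zero supported on two triangles shows that net
    flows are proportional to areas; a vanishing total then makes them all zero. *)
Lemma bform_eq0P v : \sum_T net_flow v T = 0 ->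
  (forall q, Wh M q -> bform v q = 0) <-> forall T, net_flow v T = 0.
Proof.
move=> tot; split=> [h T|h q _]; last first.
  by rewrite bformE big1 // => T _; rewrite h mulr0.
have prop T1 T2 : net_flow v T1 * area T2 = net_flow v T2 * area T1.
  have [->//|T12] := eqVneq T1 T2.
  (* These two values are chosen to have mean zero. *)
  pose q T' : R := if T' == T1 then area T2 else if T' == T2 then - area T1 else 0.
  have q1 : q T1 = area T2 by rewrite /q eqxx.
  have q2 : q T2 = - area T1 by rewrite /q eq_sym (negbTE T12) eqxx.
  have sq (f : triangle M -> R) : \sum_T q T * f T = area T2 * f T1 - area T1 * f T2.
    rewrite (bigD1 T1) //= (bigD1 T2) /=; last by rewrite eq_sym.
    rewrite q1 q2 big1 ?addr0 ?mulNr // => T' /andP[t1 t2].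
    by rewrite /q (negbTE t1) (negbTE t2) mul0r.
  have := h q; rewrite bformE sq => h'.
  have /h' : Wh M q by apply/WhP; rewrite sq mulrC subrr.
  by move=> /eqP; rewrite subr_eq0 => /eqP e; rewrite mulrC e mulrC.
have := congr1 (fun s => area T * s) tot; rewrite /= mulr0 mulr_sumr.
rewrite (eq_bigr (fun T' => net_flow v T * area T')) => [|T' _]; last first.
  by rewrite prop mulrC.
rewrite -mulr_sumr => /eqP; rewrite mulf_eq0 => /orP[/eqP //|].
rewrite gt_eqF // (bigD1 T) //= ltr_pwDl ?area_gt0 // sumr_ge0 // => T' _.
by rewrite ltW // area_gt0.
Qed.

End MeshArea.

(** * Comparing crossings from two base points *)

Section CrossingParallelogram.
Context {R : realType}.
Implicit Types (x m p q u a b y : plane R).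

(** The crossing sum along the boundary of the parallelogram of all differences
    between a point of the segment from [x] to [m] and a point of the segment
    from [p] to [q]. It compares the crossings of one segment seen from [p] and
    from [q]. *)
Definition parallelogram_crossing x m p q : R :=
  crossing (x - p) (m - p) + crossing (m - p) (m - q) +
  crossing (m - q) (x - q) + crossing (x - q) (x - p).

(** The parallelogram contains the origin only if the two segments meet; cut it
    into two triangles. *)
Lemma parallelogram_crossing_eq0 x m p q :
  (forall s t : R, 0 <= s <= 1 -> 0 <= t <= 1 ->
     x + s *: (m - x) <> p + t *: (q - p)) ->
  parallelogram_crossing x m p q = 0.
Proof.
move=> dis.
have o1 : origin_off (x - p) (m - p) (m - q).
  move=> al be ga al0 be0 ga0 pos E; have S0 : al + be + ga != 0 by rewrite gt_eqF.
  apply: (dis ((be + ga) / (al + be + ga)) (ga / (al + be + ga))).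
  - by rewrite divr_ge0 ?(ltW pos) ?addr_ge0 //= ler_pdivrMr // mul1r; lra.
  - by rewrite divr_ge0 ?(ltW pos) //= ler_pdivrMr // mul1r; lra.
  apply/eqP; rewrite -subr_eq0; apply/eqP; rewrite -(scaler0 _ (al + be + ga)^-1) -E.
  by apply: plane_eq; rewrite !planeE; field.
have o2 : origin_off (x - p) (m - q) (x - q).
  move=> al be ga al0 be0 ga0 pos E; have S0 : al + be + ga != 0 by rewrite gt_eqF.
  apply: (dis (be / (al + be + ga)) ((be + ga) / (al + be + ga))).
  - by rewrite divr_ge0 ?(ltW pos) //= ler_pdivrMr // mul1r; lra.
  - by rewrite divr_ge0 ?(ltW pos) ?addr_ge0 //= ler_pdivrMr // mul1r; lra.
  apply/eqP; rewrite -subr_eq0; apply/eqP; rewrite -(scaler0 _ (al + be + ga)^-1) -E.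
  by apply: plane_eq; rewrite !planeE; field.
have := crossing_triangle o1; have := crossing_triangle o2.
rewrite /parallelogram_crossing (crossing_anti (x - p) (m - q)); lra.
Qed.

(** The path from [- u] to [u] through [y] passes on one side of the origin or on
    the other, according to the side of [y]; the two values differ by [1].
    The first summand, common to both sides, is the value on the left. *)
Lemma crossing_opposite u y : cross u y != 0 ->
  crossing (- u) y + crossing y u =
  (if (0 < u.2) || ((u.2 == 0) && (0 < u.1)) then 0 else - 1) + ((cross u y < 0)%R)%:R.
Proof.
have uE : upper (- u) = ((u.2 <= 0)%R)%:R by rewrite /upper planeE oppr_ge0.
have cE : cross (- u) y = - cross u y by rewrite /cross !planeE; ring.
rewrite /crossing uE cE (crossC y u) /upper => c0.
have z : u.2 = 0 -> cross u y = u.1 * y.2 by rewrite /cross => ->; ring.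
move: c0 z; set c := cross u y.
case: (ltgtP u.2 0) => u2; case: (leP 0 y.2) => y2; case: (ltgtP c 0) => // cs _ z;
  rewrite /= ?subrr ?subr0 ?sub0r ?mulr0 ?mulr1 ?mulrN1 ?opprK ?ltxx ?oppr_gt0
    ?(lt_gtF cs) ?cs ?add0r ?addr0 ?addNr //.
all: by move: (z u2); case: ltP; nra.
Qed.

End CrossingParallelogram.

(** * Normal flows through edges *)

Section Flow.
Context {R : realType} {Om : set (plane R)} (M : triangulation Om).
Hypothesis oOm : open Om.
Local Notation pt := (@pt R Om M).
Local Notation cen T := (centroid (val T)).
Local Notation mid e := (midpoint (val e)).
Implicit Types (T : triangle M) (e : edge M) (a b c p : vert M) (v : Vh M).

Lemma enormN (u : plane R) : enorm (- u) = enorm u.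
Proof. by rewrite /enorm /dot !planeE !mulrNN. Qed.

Lemma enorm_gt0 (u : plane R) : u != 0 -> 0 < enorm u.
Proof. by move=> /dot_gt0; rewrite sqrtr_gt0. Qed.

Lemma enorm_sqr (u : plane R) : enorm u ^+ 2 = dot u u.
Proof. by rewrite sqr_sqrtr // addr_ge0 // -expr2 sqr_ge0. Qed.

Lemma edge_lengthE e a b : val e = [set a; b]%SET -> a != b ->
  edge_length e = enorm (pt b - pt a).
Proof.
move=> ee ab; rewrite /edge_length.
have : size (enum (val e)) = 2%N by rewrite -cardE edge_card.
have aE : a \in enum (val e) by rewrite mem_enum ee !inE eqxx.
have bE : b \in enum (val e) by rewrite mem_enum ee !inE eqxx orbT.
case: (enum _) aE bE => [|x [|y [|? ?]]] //.
rewrite !inE => /orP[] /eqP ax /orP[] /eqP bx _.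
- by move: ab; rewrite ax bx eqxx.
- by rewrite ax bx.
- by rewrite ax bx -enormN opprB.
- by move: ab; rewrite ax bx eqxx.
Qed.

Lemma orthogonal_perp (u n : plane R) : u != 0 -> dot u n = 0 ->
  n = (cross u n / dot u u) *: perp u.
Proof.
move=> u0 un; have uu0 : dot u u != 0 by rewrite gt_eqF // dot_gt0.
apply: plane_eq; apply: (mulIf uu0); rewrite !planeE /= mulrAC divfK //;
  apply/eqP; rewrite -subr_eq0; apply/eqP.
  transitivity (u.1 * dot u n); first by rewrite /dot /cross; ring.
  by rewrite un mulr0.
transitivity (u.2 * dot u n); first by rewrite /dot /cross; ring.
by rewrite un mulr0.
Qed.

(** [n] is [perp u] up to a factor of size [1 / enorm u], whose sign is detected
    by any test vector [w] off the line of [u]. *)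
Lemma normal_component (u n w v : plane R) : u != 0 -> dot u n = 0 -> enorm n = 1 ->
  cross u w != 0 ->
  enorm u * dot v n = Num.sg (dot w n) * Num.sg (cross u w) * cross u v.
Proof.
move=> u0 un n1 uw.
have uu := dot_gt0 u0; have uu0 : dot u u != 0 by rewrite gt_eqF.
pose k := cross u n / dot u u.
have en : n = k *: perp u.
  by rewrite -orthogonal_perp.
have kv x : dot x n = k * cross u x.
  by rewrite {1}en /dot /cross !planeE /=; ring.
have L0 : 0 < enorm u := enorm_gt0 u0.
have kL : (k * enorm u) ^+ 2 = 1.
  have <- : dot n n = 1 by rewrite -enorm_sqr n1 expr1n.
  have un' : cross u n = k * dot u u by rewrite /k divfK.
  by rewrite kv un' exprMn enorm_sqr expr2 mulrA.
rewrite !kv sgrM -(mulrA _ (Num.sg _) (Num.sg _)) -expr2 sqr_sg uw mulr1 mulrA; congr (_ * _).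
have : (k * enorm u == 1) || (k * enorm u == -1) by rewrite -sqrf_eq1 kL.
rewrite [enorm u * k]mulrC => /orP[] /eqP e; rewrite e; symmetry; [apply: gtr0_sg|apply: ltr0_sg].
  by rewrite -(pmulr_lgt0 _ L0) e.
by rewrite -(pmulr_llt0 _ L0) e ltrN10.
Qed.

Lemma outward_normal_exists e T : val e \subset val T -> exists n,
  unit_normal e n /\ forall a c, a \in val e -> c \in val T -> c \notin val e ->
      dot (pt c - pt a) n < 0.
Proof.
move=> eT; have [a [b [ab ee]]] := edge_vertices e.
have [c [uq ET nd]] := edge_in_triangle ee ab eT.
set u := pt b - pt a in nd; have u0 : u != 0 by exact: pt_neq.
have L0 := enorm_gt0 u0.
pose s := Num.sg (cross u (pt c - pt a)).
have s2 : s * s = 1 by rewrite -expr2 sqr_sg nd.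
exists ((- s / enorm u) *: perp u); split; first split.
- rewrite /enorm; suff -> : dot ((- s / enorm u) *: perp u) ((- s / enorm u) *: perp u) = 1.
    by rewrite sqrtr1.
  have -> : dot ((- s / enorm u) *: perp u) ((- s / enorm u) *: perp u) =
    (s * s) * (dot u u / enorm u ^+ 2).
    by rewrite /dot !planeE /=; field; rewrite gt_eqF.
  by rewrite s2 mul1r enorm_sqr divff // gt_eqF // dot_gt0.
- move=> x y; rewrite ee !inE => /orP[] /eqP -> /orP[] /eqP ->.
  + by rewrite subrr /dot /= !mul0r addr0.
  + by rewrite -/u /dot !planeE /=; ring.
  + by rewrite -opprB -/u /dot !planeE /=; ring.
  + by rewrite subrr /dot /= !mul0r addr0.
- move=> x y xe yT ye.
  have -> : y = c.
    by move: yT ye; rewrite ET ee !inE => /orP[-> //|/eqP ->].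
  have -> : dot (pt c - pt x) ((- s / enorm u) *: perp u) =
     - (s * cross u (pt c - pt a)) / enorm u.
    move: xe; rewrite ee !inE => /orP[] /eqP ->.
      by rewrite /dot /cross !planeE /=; ring.
    have -> : pt c - pt b = pt c - pt a - u by rewrite /u opprB addrA subrK.
    by rewrite /dot /cross !planeE /=; ring.
  by rewrite pmulr_llt0 ?invr_gt0 // oppr_lt0 /s -normrEsg normr_gt0.
Qed.

(** The flow through the edge from [a] to [b] without square roots; the
    centroid stands for the vertex of [T] opposite to the edge. *)
Lemma flowE v e T a b : val e = [set a; b]%SET -> a != b -> val e \subset val T ->
  flow v T e = - Num.sg (cross (pt b - pt a) (cen T - pt a)) *
               cross (pt b - pt a) (boundary_part v e).
Proof.
move=> ee ab eT; have [c [uq ET nd]] := edge_in_triangle ee ab eT.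
pose Q := [set n | unit_normal e n /\ forall a c, a \in val e -> c \in val T ->
  c \notin val e -> dot (pt c - pt a) n < 0].
have [n0 hn0] := outward_normal_exists eT.
have [[n1 nu] no] : Q (outward_normal T e) := getI (hn0 : Q n0).
rewrite /flow (edge_lengthE ee ab) (normal_component (w := pt c - pt a)) //.
- rewrite ET cross_centroid // sgrM; congr (_ * _).
  have -> : Num.sg (3^-1 : R) = 1 by rewrite gtr0_sg // invr_gt0.
  rewrite mul1r ltr0_sg ?mulN1r //.
  apply: no; rewrite ?ee ?ET !inE ?eqxx ?orbT //.
  move: uq; rewrite /= !inE negb_or andbT => /andP[/andP[_ ac] bc].
  by rewrite negb_or eq_sym ac eq_sym bc.
- exact: pt_neq.
- by apply: nu; rewrite ee !inE eqxx ?orbT.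
Qed.

(** The two conditions on the normal leave no choice of sign, since
    [cross u (perp u)] is the positive number [dot u u]. *)
Lemma ccw_normalE e p q : val e = [set p; q]%SET -> p != q ->
  ccw_normal p e = (enorm (pt q - pt p))^-1 *: perp (pt q - pt p).
Proof.
move=> ee pq; set u := pt q - pt p.
have u0 : u != 0 by exact: pt_neq.
have L0 := enorm_gt0 u0.
have uu := dot_gt0 u0; have uu0 : dot u u != 0 by rewrite gt_eqF.
pose Q := [set n | unit_normal e n /\
    forall q, q \in val e -> q != p -> 0 < cross (pt q - pt p) n].
have /getI[[n1 nu] no] : Q ((enorm u)^-1 *: perp u).
  split; first split.
  - rewrite /enorm; suff -> : dot ((enorm u)^-1 *: perp u) ((enorm u)^-1 *: perp u) = 1.
      by rewrite sqrtr1.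
    have -> : dot ((enorm u)^-1 *: perp u) ((enorm u)^-1 *: perp u) = dot u u / enorm u ^+ 2.
      by rewrite /dot !planeE /=; field; rewrite gt_eqF.
    by rewrite enorm_sqr divff.
  - move=> x y; rewrite ee !inE => /orP[] /eqP -> /orP[] /eqP ->.
    + by rewrite subrr /dot /= !mul0r addr0.
    + by rewrite -/u /dot !planeE /=; ring.
    + by rewrite -opprB -/u /dot !planeE /=; ring.
    + by rewrite subrr /dot /= !mul0r addr0.
  - move=> q'; rewrite ee !inE => /orP[/eqP -> /eqP //|/eqP -> _].
    have -> : cross (pt q - pt p) ((enorm u)^-1 *: perp u) = (enorm u)^-1 * dot u u.
      by rewrite -/u /dot /cross !planeE /=; ring.
    by rewrite mulr_gt0 // invr_gt0.
rewrite -/(ccw_normal p e) in n1 nu no *.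
set n := ccw_normal p e in n1 nu no *.
have un : dot u n = 0 by apply: nu; rewrite ee !inE eqxx ?orbT.
have cn : 0 < cross u n by apply: no; rewrite ?ee ?inE ?eqxx ?orbT // eq_sym.
have nn : dot n n = 1 by rewrite -enorm_sqr n1 expr1n.
have en : cross u n = enorm u.
  have : cross u n ^+ 2 = enorm u ^+ 2.
    rewrite enorm_sqr -[RHS]mulr1 -nn -[LHS]addr0 -[X in _ + X](mul0r 0) -un.
    by rewrite /dot /cross; ring.
  by move/eqP; rewrite eqf_sqr => /orP[/eqP //|/eqP e']; lra.
have e1 : (enorm u)^-1 = cross u n / dot u u by rewrite -enorm_sqr en; field; rewrite gt_eqF.
by rewrite e1 -orthogonal_perp.
Qed.

Lemma sum_triangles_of_edge e a b : interior_edge e -> val e = [set a; b]%SET -> a != b ->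
  exists TL TR : triangle M, [/\ val e \subset val TL, val e \subset val TR,
    0 < cross (pt b - pt a) (cen TL - pt a),
    cross (pt b - pt a) (cen TR - pt a) < 0
  & forall F : triangle M -> R, \sum_(T : triangle M | val e \subset val T) F T = F TL + F TR].
Proof.
move=> ie ee ab.
have [TL [TR [eL eR L0 R0 all]]] := interior_edge_sides oOm ie ee ab.
exists TL, TR; split => // F.
have LR : TL != TR by apply: contraTneq L0 => ->; rewrite -leNgt ltW.
rewrite (bigD1 TL) //= (bigD1 TR) /=; last by rewrite eR eq_sym.
rewrite big1 ?addr0 // => T /andP[/andP[eT tl] tr].
by case: (all T eT) => e'; [rewrite e' eqxx in tl|rewrite e' eqxx in tr].
Qed.

(** The two triangles are on opposite sides, so that their outward normals are
    opposite. *)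
Lemma flow_cancel v e : interior_edge e ->
  \sum_(T : triangle M | val e \subset val T) flow v T e = 0.
Proof.
move=> ie; have [a [b [ab ee]]] := edge_vertices e.
have [TL [TR [eL eR L0 R0 ->]]] := sum_triangles_of_edge ie ee ab.
by rewrite !(flowE _ ee ab) // (gtr0_sg L0) (ltr0_sg R0); ring.
Qed.

Lemma flow_exterior v e T : Vh0 M v -> ~~ interior_edge e -> flow v T e = 0.
Proof. by move=> v0 /v0; rewrite /flow => ->; rewrite /dot !planeE; ring. Qed.

Lemma flow_cancel0 v e : Vh0 M v -> \sum_(T : triangle M | val e \subset val T) flow v T e = 0.
Proof.
move=> v0; have [ie|ie] := boolP (interior_edge e); first exact: flow_cancel.
by rewrite big1 // => T _; exact: flow_exterior.
Qed.

Lemma net_flow_total v : Vh0 M v -> \sum_T net_flow v T = 0.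
Proof.
move=> v0; rewrite /net_flow (exchange_big_dep xpredT) //= big1 // => e _.
exact: flow_cancel0.
Qed.

(** Flows through interior edges cancel in pairs and those through boundary edges
    vanish, so the total is zero as [bform_eq0P] requires. *)
Lemma DhP v : Dh M v <-> Vh0 M v /\ forall T, net_flow v T = 0.
Proof.
split=> -[v0 h]; split => //.
  by apply/(bform_eq0P (net_flow_total v0)).
by apply/(bform_eq0P (net_flow_total v0)).
Qed.

(** A divergence-free flow is orthogonal to gradients: this is summation by
    parts on the graph whose nodes are triangles and edges. *)
Lemma flow_pairing_eq0 v (f : triangle M -> R) (g : edge M -> R) :
  Vh0 M v -> (forall T, net_flow v T = 0) ->
  \sum_(T : triangle M) \sum_(e : edge M | val e \subset val T) flow v T e * (g e - f T) = 0.
Proof.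
move=> v0 h.
under eq_bigr do (under eq_bigr do rewrite mulrBr;
  rewrite sumrB -mulr_suml -/(net_flow _ _) h mul0r subr0).
rewrite (exchange_big_dep xpredT) //= big1 // => e _.
by rewrite -mulr_suml flow_cancel0 // mul0r.
Qed.

End Flow.

(** * The discrete stream function *)

Section Stream.
Context {R : realType} {Om : set (plane R)} (M : triangulation Om).
Hypothesis oOm : open Om.
Local Notation pt := (@pt R Om M).
Local Notation cen T := (centroid (val T)).
Local Notation mid e := (midpoint (val e)).
Implicit Types (T : triangle M) (e : edge M) (v : Vh M) (p q : plane R).

(** The winding number around [p] of the flow of [v], seen as a weighted family
    of segments from centroids of triangles to midpoints of edges. *)
Definition stream v p : R :=
  \sum_(T : triangle M) \sum_(e : edge M | val e \subset val T)
    flow v T e * crossing (cen T - p) (mid e - p).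

Lemma spoke_sub e T (s : R) : interior_edge e -> val e \subset val T -> 0 <= s <= 1 ->
  Om (cen T + s *: (mid e - cen T)).
Proof.
move=> ie eT /andP[s0]; rewrite le_eqVlt => /predU1P[->|s1].
  by rewrite scale1r subrKC; apply: interior_edge_sub ie _ (mid_ohull e).
apply: (tris_inside (valP T)); apply: (ohull_segment eT).
- exact: centroid_ohull (valP T).
- exact/ohull_hull/mid_ohull.
- by rewrite s0.
Qed.

(** Walks pass from a triangle to the next through the midpoint of the common edge,
    so that each step is a segment inside [Om]; the segment between the two
    centroids could leave [Om]. *)
Definition spoke : rel (triangle M + edge M) := fun i j =>
  match i, j with
  | inl T, inr e | inr e, inl T => interior_edge e && (val e \subset val T)
  | _, _ => false
  end.

Definition node (i : triangle M + edge M) : plane R :=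
  match i with inl T => cen T | inr e => mid e end.

Lemma spoke_segment i j (s : R) : spoke i j -> 0 <= s <= 1 ->
  Om (node i + s *: (node j - node i)).
Proof.
case: i j => [T|e] [T'|e'] //= /andP[ie eT] s01; first exact: spoke_sub.
have -> : mid e + s *: (cen T' - mid e) = cen T' + (1 - s) *: (mid e - cen T').
  by apply: plane_eq; rewrite !planeE; ring.
by apply: spoke_sub => //; case/andP: s01 => ? ?; apply/andP; split; lra.
Qed.

(** Closed walks of the graph of spokes are closed polygons in [Om], and do not
    wind around [p] by [closed_polyline_crossing]. The crossings are therefore
    differences of a potential, to which a divergence-free flow is orthogonal.
    This is where simple connectedness enters. *)
Lemma stream_boundary v p : simply_connected Om -> ~ Om p ->
  Vh0 M v -> (forall T, net_flow v T = 0) -> stream v p = 0.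
Proof.
move=> scOm pOm v0 h.
have sym : connect_sym spoke.
  by apply: sym_connect_sym => -[T|e] [T'|e'].
pose w i j := crossing (node i - p) (node j - p).
have [|psi hpsi] := closed_walk_potential (w := w) sym.
  move=> x s xs lx; rewrite (walk_sumE w x).
  apply: (closed_polyline_crossing (y := fun k => node (nth x (x :: s) k)) scOm pOm).
    by rewrite /= -[in RHS]lx (last_nth x).
  by move=> k t ks t01; apply: spoke_segment t01; exact: (pathP x xs).
rewrite -[RHS](flow_pairing_eq0 oOm (psi \o inl) (psi \o inr) v0 h).
apply: eq_bigr => T _; apply: eq_bigr => e eT.
have [ie|ie] := boolP (interior_edge e); last by rewrite flow_exterior // !mul0r.
congr (_ * _); apply: (hpsi (inl T) (inr e)).
by rewrite /= ie eT.
Qed.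

(** An interior point of a triangle is on no edge, and the midpoint of an edge
    is on no other edge. *)
Lemma spoke_avoids_edge e e0 T (a b : vert M) (s t : R) :
  val e \subset val T -> e != e0 -> val e0 = [set a; b]%SET -> a != b ->
  0 <= s <= 1 -> 0 <= t <= 1 ->
  cen T + s *: (mid e - cen T) <> pt a + t *: (pt b - pt a).
Proof.
move=> eT ee0 e0E ab /andP[s0 s1] t01 E.
have [T0 eT0] := edge_triangle e0.
have h0 : hull pt (val e0) (cen T + s *: (mid e - cen T)).
  by rewrite e0E; apply/(hull2P _ _ ab); exists t.
move: s1; rewrite le_eqVlt => /predU1P[s1|s1].
  move: h0; rewrite s1 scale1r subrKC => h0.
  have := ohull_hull_face (valP T) (valP T0) eT eT0 (mid_ohull e) h0.
  move=> sub; case/negP: ee0; apply/eqP/val_inj/eqP.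
  by rewrite eqEcard sub !edge_card.
have hT : ohull pt (val T) (cen T + s *: (mid e - cen T)).
  apply: (ohull_segment eT); [exact: centroid_ohull (valP T)|exact/ohull_hull/mid_ohull|].
  by rewrite s0.
have := ohull_hull_face (valP T) (valP T0) (subxx _) eT0 hT h0.
by move/subset_leq_card; rewrite edge_card (tris_card (valP T)).
Qed.

(** Here the spoke ends in the middle of the edge, and the parallelogram has the
    origin on a side. Cutting off a triangle that avoids the origin
    leaves the two segments of [crossing_opposite]. *)
Lemma spoke_at_edge e T (a b : vert M) :
  val e \subset val T -> val e = [set a; b]%SET -> a != b ->
  parallelogram_crossing (cen T) (mid e) (pt a) (pt b) =
  (if (0 < (pt b - pt a).2) || (((pt b - pt a).2 == 0) && (0 < (pt b - pt a).1))
   then 0 else - 1) + ((cross (pt b - pt a) (cen T - pt a) < 0)%R)%:R.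
Proof.
move=> eT ee ab; have nd := centroid_side_neq0 ee ab eT.
rewrite ee midpoint2 // /parallelogram_crossing; move: nd.
have [u0 ubE] : pt b - pt a != 0 /\ pt b = pt a + (pt b - pt a) by rewrite pt_neq // subrKC.
move: (pt b - pt a) u0 ubE => u u0 -> nd.
set x := cen T in nd *.
have -> : pt a + 2^-1 *: u - pt a = 2^-1 *: u by rewrite addrC addKr.
have -> : pt a + 2^-1 *: u - (pt a + u) = - (2^-1 *: u).
  by apply: plane_eq; rewrite !planeE; field.
have -> : x - (pt a + u) = (x - pt a) - u by rewrite opprD addrA.
move: (x - pt a) nd => z uz; set h := 2^-1 *: u.
have cN : crossing h (- h) = 0.
  rewrite /crossing; have -> : cross h (- h) = 0 by rewrite /cross !planeE; ring.
  by rewrite mul0r ltxx.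
have oo : origin_off z h (z - u).
  move=> al be ga al0 be0 ga0 pos E.
  have : (al + ga) * cross u z = 0.
    transitivity (cross u (al *: z + be *: h + ga *: (z - u))).
      by rewrite /h /cross !planeE; ring.
    by rewrite E /cross !planeE; ring.
  move=> /eqP; rewrite mulf_eq0 (negbTE uz) orbF => /eqP ag.
  have al00 : al = 0 by lra.
  have ga00 : ga = 0 by lra.
  move: E; rewrite al00 ga00 !scale0r add0r addr0 /h => /eqP.
  by rewrite !scaler_eq0 (negbTE u0) invr_eq0 pnatr_eq0 !orbF => /eqP; lra.
have hz : cross h (z - u) = 2^-1 * cross u z by rewrite /h /cross !planeE; ring.
have := crossing_opposite (u := h) (y := z - u).
rewrite hz mulf_neq0 ?invr_eq0 ?pnatr_eq0 // => /(_ isT).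
rewrite pmulr_rlt0 ?invr_gt0 // /h !planeE pmulr_rgt0 ?invr_gt0 // pmulr_rgt0 ?invr_gt0 //.
rewrite mulf_eq0 invr_eq0 pnatr_eq0 /= -/h => <-.
have := crossing_triangle oo; rewrite cN (crossing_anti h (z - u)); lra.
Qed.

(** Passing from [a] to [b] changes the crossings of a spoke by a
    gradient, orthogonal to the flow, plus a [parallelogram_crossing], which
    vanishes except for the two spokes that end on [e0]. These differ by [1]
    and carry opposite flows, so that one flow through [e0] remains. *)
Lemma stream_edge v e0 (a b : vert M) :
  Vh0 M v -> (forall T, net_flow v T = 0) ->
  interior_edge e0 -> val e0 = [set a; b]%SET -> a != b ->
  stream v (pt a) - stream v (pt b) = cross (pt b - pt a) (boundary_part v e0).
Proof.
move=> v0 h ie ee ab.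
pose hh x := crossing (x - pt a) (x - pt b).
have step T e : crossing (cen T - pt a) (mid e - pt a) - crossing (cen T - pt b) (mid e - pt b) =
  parallelogram_crossing (cen T) (mid e) (pt a) (pt b) - (hh (mid e) - hh (cen T)).
  rewrite /parallelogram_crossing /hh (crossing_anti (cen T - pt b) (mid e - pt b)).
  rewrite (crossing_anti (cen T - pt a) (cen T - pt b)); ring.
have -> : stream v (pt a) - stream v (pt b) = \sum_(T : triangle M)
    \sum_(e : edge M | val e \subset val T)
    flow v T e * parallelogram_crossing (cen T) (mid e) (pt a) (pt b).
  rewrite /stream -sumrB -[RHS]subr0.
  have pairing := flow_pairing_eq0 oOm (fun T => hh (cen T)) (fun e => hh (mid e)) v0 h.
  rewrite -[X in _ = _ - X]pairing.
  rewrite -[RHS]sumrB.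
  apply: eq_bigr => T _; rewrite -!sumrB; apply: eq_bigr => e _.
  by rewrite -!mulrBr step.
rewrite (exchange_big_dep xpredT) //= (bigD1 e0) //= [X in _ + X]big1 ?addr0; last first.
  move=> e ee0; rewrite big1 // => T eT.
  rewrite parallelogram_crossing_eq0 ?mulr0 // => s t s01 t01.
  exact: (spoke_avoids_edge eT ee0 ee ab s01 t01).
have [TL [TR [eL eR L0 R0 ->]]] := sum_triangles_of_edge oOm ie ee ab.
rewrite !(flowE _ ee ab) // !(spoke_at_edge _ ee ab) //.
rewrite (gtr0_sg L0) (ltr0_sg R0) R0 (lt_gtF L0) mulr1n mulr0n addr0.
by move: (if _ then _ else _) => K; ring.
Qed.

End Stream.

(** * The basis *)

Section IndexedFamilies.
Context {K : fieldType} {V : vectType K} {J : eqType} (F : J -> V).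

(** Indexing a family by [J] instead of by positions in a list keeps
    the four kinds of basis functions apart in linear combinations. *)
Lemma mem_span_map (s : seq J) (v : V) : uniq s ->
  v \in <<[seq F j | j <- s]>>%VS -> exists c : J -> K, v = \sum_(j <- s) c j *: F j.
Proof.
elim: s v => [|j s IH] v /=.
  by rewrite span_nil memv0 => _ /eqP ->; exists (fun=> 0); rewrite big_nil.
case/andP=> js us; rewrite span_cons => /memv_addP[_ /vlineP[k ->] [w /(IH _ us)[c ->] ->]].
exists (fun i => if i == j then k else c i).
rewrite big_cons eqxx; congr (_ + _); apply: eq_big_seq => i si.
by case: eqP si js => // -> ->.
Qed.

Lemma free_map (s : seq J) : uniq s ->
  (forall c : J -> K, \sum_(j <- s) c j *: F j = 0 -> {in s, forall j, c j = 0}) ->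
  free [seq F j | j <- s].
Proof.
elim: s => [|j s IH] /=; first by rewrite nil_free.
case/andP=> js us h; rewrite free_cons; apply/andP; split.
  apply/negP => /(mem_span_map us)[c e].
  have := h (fun i => if i == j then -1 else c i).
  rewrite big_cons eqxx (eq_big_seq (fun i => c i *: F i)); last first.
    by move=> i si; case: eqP si js => // -> ->.
  rewrite -e scaleN1r addNr => /(_ erefl j); rewrite inE eqxx => /(_ isT) /eqP.
  by rewrite oppr_eq0 oner_eq0.
apply: IH => // c e i si.
have := h (fun i => if i == j then 0 else c i).
rewrite big_cons eqxx (eq_big_seq (fun i => c i *: F i)); last first.
  by move=> k sk; case: eqP sk js => // -> ->.
rewrite e scale0r addr0 => /(_ erefl i); rewrite inE si orbT => /(_ isT).
by case: eqP si js => // -> ->.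
Qed.

End IndexedFamilies.

Section Basis.
Context {R : realType} {Om : set (plane R)} (M : triangulation Om).
Hypothesis oOm : open Om.
Variable tau : edge M -> plane R.
Local Notation pt := (@pt R Om M).
Local Notation cen T := (centroid (val T)).
Implicit Types (T : triangle M) (e : edge M) (v : Vh M) (a b c p q : vert M).

Lemma Vh_eq (v w : Vh M) : (forall T, interior_part v T = interior_part w T) ->
  (forall e, boundary_part v e = boundary_part w e) -> v = w.
Proof.
case: v w => [[v1 v2] [v3 v4]] [[w1 w2] [w3 w4]] hi hb.
congr ((_, _), (_, _)); apply/ffunP => x.
- by case: (hi x).
- by case: (hb x).
- by case: (hi x).
- by case: (hb x).
Qed.

Lemma ffunDE (I : finType) (f g : {ffun I -> R^o}) i : (f + g) i = f i + g i.
Proof. by rewrite ffunE. Qed.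

Lemma ffunZE (I : finType) (k : R) (f : {ffun I -> R^o}) i : (k *: f) i = k * f i.
Proof. by rewrite ffunE. Qed.

Lemma interior_partD v w T : interior_part (v + w) T = interior_part v T + interior_part w T.
Proof. by apply: plane_eq; exact: ffunDE. Qed.

Lemma interior_partZ (k : R) v T : interior_part (k *: v) T = k *: interior_part v T.
Proof. by apply: plane_eq; exact: ffunZE. Qed.

Lemma interior_part0 T : interior_part (0 : Vh M) T = 0.
Proof. by rewrite /interior_part !ffunE. Qed.

Lemma boundary_partD v w e : boundary_part (v + w) e = boundary_part v e + boundary_part w e.
Proof. by apply: plane_eq; exact: ffunDE. Qed.

Lemma boundary_partZ (k : R) v e : boundary_part (k *: v) e = k *: boundary_part v e.
Proof. by apply: plane_eq; exact: ffunZE. Qed.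

Lemma boundary_part0 e : boundary_part (0 : Vh M) e = 0.
Proof. by rewrite /boundary_part !ffunE. Qed.

Lemma interior_part_sum (I : Type) (r : seq I) (P : pred I) (F : I -> Vh M) T :
  interior_part (\sum_(i <- r | P i) F i) T = \sum_(i <- r | P i) interior_part (F i) T.
Proof.
by apply: (big_morph (fun v => interior_part v T)) => [v w|];
  [exact: interior_partD|exact: interior_part0].
Qed.

Lemma boundary_part_sum (I : Type) (r : seq I) (P : pred I) (F : I -> Vh M) e :
  boundary_part (\sum_(i <- r | P i) F i) e = \sum_(i <- r | P i) boundary_part (F i) e.
Proof.
by apply: (big_morph (fun v => boundary_part v e)) => [v w|];
  [exact: boundary_partD|exact: boundary_part0].
Qed.

Lemma boundary_part_psi (x y : R) e e' :
  boundary_part (x *: Psi1 e + y *: Psi2 e) e' = (e' == e)%:R *: (x, y).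
Proof.
rewrite /boundary_part /=; apply: plane_eq; rewrite !planeE /= !ffunE /=;
 by rewrite /GRing.scale /= ?mulr0 ?addr0 ?add0r mulrC.
Qed.

Lemma interior_part_psi (x y : R) e T : interior_part (x *: Psi1 e + y *: Psi2 e) T = 0.
Proof.
rewrite /interior_part /=; apply: plane_eq; rewrite /= !ffunE /=;
 by rewrite /GRing.scale /= ?mulr0 ?addr0.
Qed.

Lemma interior_part_Phi1 T T' : interior_part (Phi1 T) T' = ((T' == T)%:R, 0).
Proof. by rewrite /interior_part /= !ffunE. Qed.

Lemma interior_part_Phi2 T T' : interior_part (Phi2 T) T' = (0, (T' == T)%:R).
Proof. by rewrite /interior_part /= !ffunE. Qed.

Lemma boundary_part_Phi1 T e : boundary_part (Phi1 T) e = 0.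
Proof. by rewrite /boundary_part /= !ffunE. Qed.

Lemma boundary_part_Phi2 T e : boundary_part (Phi2 T) e = 0.
Proof. by rewrite /boundary_part /= !ffunE. Qed.

Lemma boundary_part_Lambda p e : boundary_part (Lambda p) e =
  if interior_edge e && (p \in val e) then (edge_length e)^-1 *: ccw_normal p e else 0.
Proof.
rewrite /Lambda boundary_part_sum big_mkcond (bigD1 e) //= big1 ?addr0 => [|e' ee'].
  by case: ifP => // _; rewrite boundary_partZ boundary_part_psi eqxx scale1r -surjective_pairing.
case: ifP => // _.
by rewrite boundary_partZ boundary_part_psi eq_sym (negbTE ee') scale0r scaler0.
Qed.

Definition combination (f1 f2 : triangle M -> R) (g : edge M -> R) (c : vert M -> R) : Vh M :=
  \sum_T f1 T *: Phi1 T + (\sum_T f2 T *: Phi2 T +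
  (\sum_(e in @interior_edge R Om M) g e *: Upsilon tau e +
   \sum_(p in @interior_vertex R Om M) c p *: Lambda p)).

Lemma interior_part_combination f1 f2 g (c : vert M -> R) T :
  interior_part (combination f1 f2 g c) T = (f1 T, f2 T).
Proof.
rewrite /combination !interior_partD !interior_part_sum.
rewrite [X in _ + (_ + (X + _))]big1 ?[X in _ + (_ + (_ + X))]big1 ?addr0; last first.
- by move=> e _; rewrite interior_partZ interior_part_psi scaler0.
- move=> p _; rewrite interior_partZ /Lambda interior_part_sum big1 ?scaler0 // => e _.
  by rewrite interior_partZ interior_part_psi scaler0.
rewrite (bigD1 T) //= [X in _ + X + _]big1 ?addr0 => [|T' TT']; last first.
  rewrite interior_partZ interior_part_Phi1 eq_sym (negbTE TT').
  by apply: plane_eq; rewrite !planeE /= mulr0.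
rewrite (bigD1 T) //= [X in _ + (_ + X)]big1 ?addr0 => [|T' TT']; last first.
  rewrite interior_partZ interior_part_Phi2 eq_sym (negbTE TT').
  by apply: plane_eq; rewrite !planeE /= mulr0.
rewrite !interior_partZ interior_part_Phi1 interior_part_Phi2 eqxx.
by apply: plane_eq; rewrite !planeE /= ?mulr0 ?mulr1 ?addr0 ?add0r.
Qed.

Definition interior_value (c : vert M -> R) p : R := if interior_vertex p then c p else 0.

(** On the edge from [a] to [b] only the functions of its two vertices are
    nonzero, and their counterclockwise normals are opposite. *)
Lemma boundary_part_combination f1 f2 g (c : vert M -> R) e a b :
  val e = [set a; b]%SET -> a != b ->
  boundary_part (combination f1 f2 g c) e =
  if interior_edge e then g e *: tau e +
    ((interior_value c a - interior_value c b) / dot (pt b - pt a) (pt b - pt a))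
      *: perp (pt b - pt a)
  else 0.
Proof.
move=> ee ab; rewrite /combination !boundary_partD !boundary_part_sum.
rewrite big1 ?add0r => [|T _]; last by rewrite boundary_partZ boundary_part_Phi1 scaler0.
rewrite big1 ?add0r => [|T _]; last by rewrite boundary_partZ boundary_part_Phi2 scaler0.
have Ups e' : boundary_part (g e' *: Upsilon tau e') e = (e == e')%:R *: (g e' *: tau e').
  rewrite boundary_partZ boundary_part_psi -surjective_pairing.
  by rewrite !scalerA mulrC.
(* The scaled normal is free of square roots. *)
have dir p q : val e = [set p; q]%SET -> p != q ->
    (edge_length e)^-1 *: ccw_normal p e = (dot (pt q - pt p) (pt q - pt p))^-1 *: perp (pt q - pt p).
  move=> ee' pq; rewrite (edge_lengthE ee' pq) (ccw_normalE ee' pq) scalerA.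
  by rewrite -invfM -expr2 enorm_sqr.
have [ie|ie] := ifPn; last first.
  rewrite big1 ?add0r => [|e' ie']; last first.
    rewrite Ups; case: eqP => [e'E|_]; last by rewrite scale0r.
    by move: ie; rewrite e'E (ie' : interior_edge e').
  by rewrite big1 // => p _; rewrite boundary_partZ boundary_part_Lambda (negbTE ie) scaler0.
congr (_ + _).
  rewrite (bigD1 e) //= big1 ?addr0 => [|e' /andP[_ ee']].
    by rewrite Ups eqxx scale1r.
  by rewrite Ups eq_sym (negbTE ee') scale0r.
rewrite (eq_bigr (fun p => interior_value c p *: boundary_part (Lambda p) e)) => [|p ip]; last first.
  by rewrite boundary_partZ /interior_value (ip : interior_vertex p).
rewrite big_mkcond /= (eq_bigr (fun p => interior_value c p *: boundary_part (Lambda p) e)); last first.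
  move=> p _; case: ifPn => // /negbTE ip.
  by rewrite /interior_value (ip : interior_vertex p = false) scale0r.
rewrite (sum_support2 ab) => [|p pe]; last first.
  by rewrite boundary_part_Lambda ee (negbTE pe) andbF scaler0.
have ae : a \in val e by rewrite ee !inE eqxx.
have be : b \in val e by rewrite ee !inE eqxx orbT.
have eba : val e = [set b; a]%SET by rewrite ee finset.setUC.
move: (interior_value c a) (interior_value c b) => ca cb.
have ba : b != a by rewrite eq_sym.
have La := boundary_part_Lambda a e.
rewrite ie ae /= (dir a b ee ab) in La.
have Lb := boundary_part_Lambda b e.
rewrite ie be /= (dir b a eba ba) in Lb.
apply: etrans (congr2 +%R (congr1 ( *:%R ca) La) (congr1 ( *:%R cb) Lb)) _.
have -> : dot (pt a - pt b) (pt a - pt b) = dot (pt b - pt a) (pt b - pt a).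
  by rewrite /dot !planeE; ring.
by apply: plane_eq; rewrite /perp !planeE /=; ring.
Qed.

End Basis.

Section FinalBasis.
Context {R : realType} {Om : set (plane R)} (M : triangulation Om).
Hypothesis oOm : open Om.
Variable tau : edge M -> plane R.
Hypothesis tau_tangent : forall e, interior_edge e -> unit_tangent e (tau e).
Local Notation pt := (@pt R Om M).
Local Notation cen T := (centroid (val T)).
Local Notation basis_index := ((triangle M + triangle M) + (edge M + vert M))%type.
Implicit Types (T : triangle M) (e : edge M) (v : Vh M) (a b p q : vert M).

Lemma edge_of_triangle T a b : a \in val T -> b \in val T -> a != b ->
  exists e : edge M, val e = [set a; b]%SET.
Proof.
move=> aT bT ab.
have ie : is_edge (M := M) [set a; b]%SET.
  rewrite /is_edge cards2 ab eqxx; apply/existsP; exists (val T).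
  by rewrite (valP T) finset.subUset !finset.sub1set aT bT.
by exists (Sub [set a; b]%SET ie); rewrite SubK.
Qed.

Lemma sum_edges_of_triangle T a b c : uniq [:: a; b; c] -> val T = [set a; b; c]%SET ->
  exists e1 e2 e3 : edge M, [/\ val e1 = [set a; b]%SET, val e2 = [set b; c]%SET,
    val e3 = [set c; a]%SET
  & forall F : edge M -> R, \sum_(e : edge M | val e \subset val T) F e = F e1 + F e2 + F e3].
Proof.
move=> u ET; move: (u); rewrite /= !inE negb_or andbT => /andP[/andP[ab ac] bc].
have aT : a \in val T by rewrite ET !inE eqxx.
have bT : b \in val T by rewrite ET !inE eqxx orbT.
have cT : c \in val T by rewrite ET !inE eqxx !orbT.
have ca : c != a by rewrite eq_sym.
have [e1 E1] := edge_of_triangle aT bT ab.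
have [e2 E2] := edge_of_triangle bT cT bc.
have [e3 E3] := edge_of_triangle cT aT ca.
exists e1, e2, e3; split => // F.
have s1 : val e1 \subset val T by rewrite E1 finset.subUset !finset.sub1set aT bT.
have s2 : val e2 \subset val T by rewrite E2 finset.subUset !finset.sub1set bT cT.
have s3 : val e3 \subset val T by rewrite E3 finset.subUset !finset.sub1set cT aT.
have n12 : e2 != e1.
  apply/eqP => /(congr1 val); rewrite E1 E2 => /setP /(_ a).
  by rewrite !inE eqxx (negbTE ab) (negbTE ac).
have n13 : e3 != e1.
  apply/eqP => /(congr1 val); rewrite E1 E3 => /setP /(_ b).
  by rewrite !inE eqxx orbT (negbTE bc) eq_sym (negbTE ab).
have n23 : e3 != e2.
  apply/eqP => /(congr1 val); rewrite E2 E3 => /setP /(_ a).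
  by rewrite !inE eqxx orbT (negbTE ab) (negbTE ac).
rewrite (bigD1 e1) //= (bigD1 e2) /=; last by rewrite s2 n12.
rewrite (bigD1 e3) /=; last by rewrite s3 n13 n23.
rewrite big1 ?addr0 ?addrA // => e /andP[/andP[/andP[eT ne1] ne2] ne3].
have [x [y [xy Exy]]] := edge_vertices e.
have {}eT : val e \subset val T by [].
have nval e' : e != e' -> val e != val e' by apply: contra => /eqP /val_inj ->.
move: (nval _ ne1) (nval _ ne2) (nval _ ne3) eT; rewrite E1 E2 E3 ET Exy.
rewrite finset.subUset !finset.sub1set !inE => n1 n2 n3 /andP[].
move=> /orP[/orP[]|] /eqP xe /orP[/orP[]|] /eqP ye; move: xy n1 n2 n3;
  by rewrite xe ye ?[[set b; a]%SET]finset.setUC ?[[set c; b]%SET]finset.setUC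
     ?[[set a; c]%SET]finset.setUC ?eqxx.
Qed.

Lemma cross_tangent e a b : interior_edge e -> val e = [set a; b]%SET ->
  cross (pt b - pt a) (tau e) = 0.
Proof. by move=> /tau_tangent[_ ct] ee; apply: ct; rewrite ee !inE eqxx ?orbT. Qed.

(** The tangential part does not contribute. On a boundary edge both sides vanish,
    since neither end is an interior vertex. *)
Lemma cross_combination (f1 f2 : triangle M -> R) g (c : vert M -> R) e a b :
  val e = [set a; b]%SET -> a != b ->
  cross (pt b - pt a) (boundary_part (combination tau f1 f2 g c) e) =
  interior_value c a - interior_value c b.
Proof.
move=> ee ab; rewrite (boundary_part_combination tau f1 f2 g c ee ab).
have uu : dot (pt b - pt a) (pt b - pt a) != 0 by rewrite gt_eqF // dot_gt0 // pt_neq.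
have [ie|ie] := ifPn.
  have := cross_tangent ie ee; move: uu; rewrite /cross /dot !planeE => uu ct.
  transitivity (g e * 0 + (interior_value c a - interior_value c b)).
    by rewrite -ct /=; field.
  by rewrite mulr0 add0r.
have out p : p \in val e -> interior_value c p = 0.
  rewrite /interior_value => pe; case: ifPn => // ip.
  by rewrite (interior_vertex_edge ip pe) in ie.
rewrite !out ?ee ?inE ?eqxx ?orbT // subrr.
by rewrite /cross /= !mulr0 subrr.
Qed.

(** Around a triangle the differences of vertex values telescope. *)
Lemma combination_Dh (f1 f2 : triangle M -> R) g (c : vert M -> R) :
  Dh M (combination tau f1 f2 g c).
Proof.
apply/(DhP oOm); split.
  move=> e ie; have [a [b [ab ee]]] := edge_vertices e.
  by rewrite (boundary_part_combination tau f1 f2 g c ee ab) (negbTE ie).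
move=> T; have [x [y [z [u ET]]]] := tri_vertices (valP T).
have [e1 [e2 [e3 [E1 E2 E3 sumE]]]] := sum_edges_of_triangle u ET.
move: (u); rewrite /= !inE negb_or andbT => /andP[/andP[xy xz] yz].
have zx : z != x by rewrite eq_sym.
rewrite /net_flow sumE.
have eT (e : edge M) a b : a \in val T -> b \in val T -> val e = [set a; b]%SET -> val e \subset val T.
  by move=> aT bT ->; rewrite finset.subUset !finset.sub1set aT bT.
have xT : x \in val T by rewrite ET !inE eqxx.
have yT : y \in val T by rewrite ET !inE eqxx orbT.
have zT : z \in val T by rewrite ET !inE eqxx !orbT.
rewrite (flowE _ E1 xy (eT _ _ _ xT yT E1)) (flowE _ E2 yz (eT _ _ _ yT zT E2)).
rewrite (flowE _ E3 zx (eT _ _ _ zT xT E3)).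
rewrite (cross_combination _ _ _ _ E1 xy) (cross_combination _ _ _ _ E2 yz).
rewrite (cross_combination _ _ _ _ E3 zx).
have cE : cen T = 3^-1 *: pt x + 3^-1 *: pt y + 3^-1 *: pt z by rewrite ET centroid3.
have -> : cross (pt z - pt y) (cen T - pt y) = cross (pt y - pt x) (cen T - pt x).
  by rewrite cE /cross !planeE; field.
have -> : cross (pt x - pt z) (cen T - pt z) = cross (pt y - pt x) (cen T - pt x).
  by rewrite cE /cross !planeE; field.
ring.
Qed.

(** [t] is a multiple of [u], so this is the decomposition along [u] and
    [perp u]. *)
Lemma tangent_normal_decomp (w t u : plane R) : u != 0 -> enorm t = 1 -> cross u t = 0 ->
  w = dot w t *: t + (cross u w / dot u u) *: perp u.
Proof.
move=> u0 t1 ut; have uu := dot_gt0 u0; have uu0 : dot u u != 0 by rewrite gt_eqF.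
have tt : dot t t = 1 by rewrite -enorm_sqr t1 expr1n.
pose k := dot u t / dot u u.
have tE : t = k *: u.
  apply: plane_eq; apply: (mulIf uu0); rewrite !planeE /k mulrAC divfK //;
    apply/eqP; rewrite -subr_eq0; apply/eqP.
    transitivity (- u.2 * cross u t); first by rewrite /dot /cross; ring.
    by rewrite ut mulr0.
  transitivity (u.1 * cross u t); first by rewrite /dot /cross; ring.
  by rewrite ut mulr0.
have kk : k * k = (dot u u)^-1.
  apply: (mulIf uu0); rewrite mulVf // -tt [in RHS]tE /dot !planeE; ring.
have -> : dot w t *: t = (dot w u / dot u u) *: u.
  by rewrite {1 2}tE -kk; apply: plane_eq; rewrite /dot !planeE; ring.
by apply: plane_eq; apply: (mulIf uu0); rewrite !planeE /= /dot /cross;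
  move: uu0; rewrite /dot => uu0; field.
Qed.

(** The stream function supplies the vertex coefficients: its differences are the
    normal components by [stream_edge], and it vanishes at boundary vertices by
    [stream_boundary]. *)
Lemma Dh_combination v : simply_connected Om -> Dh M v ->
  v = combination tau (v.1.1) (v.2.1) (fun e => dot (boundary_part v e) (tau e))
        (fun p => stream v (pt p)).
Proof.
move=> scOm /(DhP oOm)[v0 h]; apply: Vh_eq => [T|e].
  by rewrite interior_part_combination.
have [a [b [ab ee]]] := edge_vertices e.
rewrite (boundary_part_combination tau _ _ _ _ ee ab).
have [ie|ie] := ifPn; last exact: v0.
have [T eT] := edge_triangle e.
have iv p : p \in val e -> interior_value (fun p => stream v (pt p)) p = stream v (pt p).
  move=> pe; rewrite /interior_value; case: ifPn => // ip.
  rewrite stream_boundary //; apply: boundary_vertex_notin ip => //.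
  exact: (fintype.subsetP eT).
rewrite !iv ?ee ?inE ?eqxx ?orbT //.
rewrite (stream_edge oOm v0 h ie ee ab).
have [t1 _] := tau_tangent ie.
exact: tangent_normal_decomp (pt_neq ab) t1 (cross_tangent ie ee).
Qed.

(** Consider the rightmost vertex where the value is nonzero. It is interior, so
    the triangle met by going right from it has all its vertices joined to
    it by interior edges; they carry the same value, hence lie no further to
    the right, while the triangle contains a point that does. *)
Lemma interior_value_constant_eq0 (c : vert M -> R) :
  (forall e a b, interior_edge e -> val e = [set a; b]%SET -> a != b ->
     interior_value c a = interior_value c b) ->
  forall p, interior_value c p = 0.
Proof.
move=> hc p0; apply/eqP; apply/negPn/negP => cp0.
have : exists p, interior_value c p != 0 /\
    forall q, interior_value c q != 0 -> (pt q).1 <= (pt p).1.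
  case: (@Order.TotalTheory.arg_maxP _ R _ p0
    (fun p => interior_value c p != 0) (fun p => (pt p).1) cp0).
  by move=> p cp mx; exists p.
case=> p [cp mx].
have ip : interior_vertex p by move: cp; rewrite /interior_value; case: ifP; rewrite ?eqxx.
have [s [T [s0 pT hT]]] := vertex_ray_cover oOm (1, 0) ip.
have ci q : q \in val T -> interior_value c q != 0.
  move=> qT; have [-> //|qp] := eqVneq q p.
  have pq : p != q by rewrite eq_sym.
  have [e ee] := edge_of_triangle pT qT pq.
  rewrite -(hc e p q) //; apply: (interior_vertex_edge ip).
  by rewrite ee !inE eqxx.
case: hT => w [w0 wT ws] /(congr1 fst).
rewrite (big_morph fst (id1 := 0) (op1 := +%R)) // !planeE /= mulr1 => E.
have : \sum_i w i * (pt i).1 <= \sum_i w i * (pt p).1.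
  apply: ler_sum => i _; have [iT|iT] := boolP (i \in val T); last by rewrite wT // !mul0r.
  by rewrite ler_wpM2l // mx // ci.
rewrite -mulr_suml ws mul1r.
have -> : \sum_i w i * (pt i).1 = (pt p).1 + s by rewrite E.
lra.
Qed.

(** The coefficients of the vertex functions have equal values at the ends
    of each interior edge, so [interior_value_constant_eq0] applies. *)
Lemma combination_eq0 (f1 f2 : triangle M -> R) g (c : vert M -> R) :
  combination tau f1 f2 g c = 0 ->
  [/\ forall T, f1 T = 0, forall T, f2 T = 0, forall e, interior_edge e -> g e = 0
    & forall p, interior_vertex p -> c p = 0].
Proof.
move=> h0.
have hi T : (f1 T, f2 T) = (0, 0) :> plane R.
  by rewrite -(interior_part_combination tau f1 f2 g c T) h0 interior_part0.
have hb e : boundary_part (combination tau f1 f2 g c) e = 0 by rewrite h0 boundary_part0.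
have cc e a b : interior_edge e -> val e = [set a; b]%SET -> a != b ->
    interior_value c a = interior_value c b.
  move=> ie ee ab; apply/eqP; rewrite -subr_eq0 -(cross_combination f1 f2 g c ee ab) hb.
  by rewrite /cross /= !mulr0 subrr.
have c0 := interior_value_constant_eq0 cc.
split => [T|T|e ie|p ip].
- by case: (hi T).
- by case: (hi T).
- have [a [b [ab ee]]] := edge_vertices e.
  have := hb e; rewrite (boundary_part_combination tau f1 f2 g c ee ab) ie !c0.
  rewrite subrr mul0r scale0r addr0.
  move/eqP; rewrite scaler_eq0 => /orP[/eqP //|/eqP t0].
  have [t1 _] := tau_tangent ie.
  have : enorm (tau e) ^+ 2 = 0 by rewrite enorm_sqr t0 /dot /= mulr0 addr0.
  by rewrite t1 expr1n => /eqP; rewrite oner_eq0.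
- by have := c0 p; rewrite /interior_value ip.
Qed.

Definition basis_vector (j : (triangle M + triangle M) + (edge M + vert M)) : Vh M :=
  match j with
  | inl (inl T) => Phi1 T
  | inl (inr T) => Phi2 T
  | inr (inl e) => Upsilon tau e
  | inr (inr p) => Lambda p
  end.

Definition basis_indices : seq basis_index :=
  [seq inl (inl T) | T <- enum {: triangle M}] ++ [seq inl (inr T) | T <- enum {: triangle M}] ++
  [seq inr (inl e) | e <- enum (@interior_edge R Om M)] ++
  [seq inr (inr p) | p <- enum (@interior_vertex R Om M)].

Lemma div_free_basisE : div_free_basis tau = [seq basis_vector j | j <- basis_indices].
Proof. by rewrite /div_free_basis /basis_indices !map_cat -!map_comp. Qed.

Lemma basis_indices_uniq : uniq basis_indices.
Proof.
have in_img (A B : eqType) (f : A -> B) (s : seq A) (x : B) :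
  x \in map f s -> exists y, x = f y by case/mapP => y _ ->; exists y.
have inj_uniq (A : finType) (B : eqType) (P : pred A) (f : A -> B) :
    injective f -> uniq [seq f x | x <- enum P].
  by move=> fI; rewrite map_inj_uniq // enum_uniq.
rewrite /basis_indices !cat_uniq; apply/and3P; split.
- by apply: inj_uniq => ? ? [].
- apply/hasPn => x; rewrite !mem_cat => /or3P[] /in_img[y ->];
  by apply/negP => /in_img[].
- apply/and3P; split; first by apply: inj_uniq => ? ? [].
    apply/hasPn => x; rewrite !mem_cat => /orP[] /in_img[y ->];
    by apply/negP => /in_img[].
  apply/and3P; split; try by apply: inj_uniq => ? ? [].
  by apply/hasPn => x /in_img[y ->]; apply/negP => /in_img[].
Qed.

Lemma sum_basis_indices (k : (triangle M + triangle M) + (edge M + vert M) -> R) :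
  \sum_(j <- basis_indices) k j *: basis_vector j =
  combination tau (fun T => k (inl (inl T))) (fun T => k (inl (inr T)))
    (fun e => k (inr (inl e))) (fun p => k (inr (inr p))).
Proof. by rewrite /basis_indices !big_cat !big_map !big_enum. Qed.

End FinalBasis.

Theorem lemma5p1 (R : realType) (Om : set (plane R)) (M : triangulation Om)
    (sigma : R) (tau : edge M -> plane R) :
  domain Om -> simply_connected Om ->
  shape_regular M sigma ->
  (forall e, interior_edge e -> unit_tangent e (tau e)) ->
  free (div_free_basis tau) /\
  [set v | v \in <<div_free_basis tau>>%VS] = Dh M.
Proof.
move=> [oOm _ _] scOm _ ttan; rewrite div_free_basisE; split.
  apply: free_map (basis_indices_uniq M) _ => k.
  rewrite sum_basis_indices => /(combination_eq0 oOm ttan)[k1 k2 k3 k4].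
  move=> j; rewrite !mem_cat => /or4P[] /mapP[x xin ->] //.
  - by apply: k3; rewrite mem_enum in xin.
  - by apply: k4; rewrite mem_enum in xin.
apply/seteqP; split => v /=.
  move=> /(mem_span_map (basis_indices_uniq M))[k ->].
  rewrite sum_basis_indices; exact: combination_Dh.
move=> /(Dh_combination oOm ttan scOm) ->.
pose k (j : (triangle M + triangle M) + (edge M + vert M)) : R :=
  match j with
  | inl (inl T) => v.1.1 T | inl (inr T) => v.2.1 T
  | inr (inl e) => dot (boundary_part v e) (tau e)
  | inr (inr p) => stream v (pt p) end.
rewrite -[X in X \in _](sum_basis_indices tau k) big_seq.
apply: memv_suml => j js; apply/memvZ/memv_span/map_f; exact: js.
Qed.
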